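(* Let $G$ be a locally compact, second countable, $\sigma$-compact Abelian group which is not compact. Let $\mu,\nu\in DM$ be translation bounded Fourier transformable measures on $G$ such that their Fourier transforms $\hat\mu,\hat\nu$ are pure point measures on $\hat G$. If $\mu$ and $\nu$ come close to infinity, then $\mu=\nu$.
   Context: $G$ is written additively, and $\hat G$ denotes the group of (continuous unitary) characters of $G$. $C_c(G)$ is the space of compactly supported continuous complex functions on $G$, and $K_2(G)$ is the linear span of $\{f_1\star f_2:\ f_1,f_2\in C_c(G)\}$, where $\star$ is convolution with respect to Haar measure. A Radon measure on $G$ (or on $\hat G$) is a complex-valued $\sigma$-additive set function $\mu$, defined on relatively compact Borel sets, whose variation $|\mu|$ is finite on every compact set and which is inner regular: for every $\varepsilon>0$ and every relatively compact Borel set $A$ there is a compact $K_\varepsilon\subset A$ with $|\mu|(A\setminus K_\varepsilon)<\varepsilon$. All measures are Radon measures in this sense. Such a measure need not have finite total variation. A measure $\mu$ on $G$ with support $\Lambda$ is discrete if each $\lambda\in\Lambda$ has a neighborhood $\lambda+U$ with $(\lambda+U)\cap\Lambda=\{\lambda\}$; then one writes $\mu=\sum_{\lambda\in\Lambda}\mu(\lambda)\delta_\lambda$ with $\mu(\lambda)\in\mathbb{C}$, where $\delta_\lambda$ is the unit mass at $\lambda$. $\mu$ is translation bounded if $\sup_{t\in G}|\mu|(K+t)<\infty$ for every compact $K\subset G$. $\mu$ is Fourier transformable if there is a measure $\hat\mu$ on $\hat G$ (its Fourier transform) such that for all $g\in K_2(G)$: (i) $(\mu,g)=(\hat\mu,\check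 g)$, and (ii) $\hat g\in L^1(|\hat\mu|)$. Here $(\mu,g)=\int g\,d\mu$, $\hat g$ is the Fourier transform of $g$ and $\check g$ is the inverse Fourier transform of $g$ (both functions on $\hat G$). A measure is pure point if it is a sum of point masses (its atoms need not be isolated). $DM$ is the class of discrete Radon measures $\mu$ on $G$ such that for some neighborhood $U$ of $0$, $\sup_{x\in G}\#\{(x+U)\cap\operatorname{supp}\mu\}<\infty$, where $\#$ denotes the number of points. Discrete measures $\mu=\sum_{\lambda\in\Lambda}\mu(\lambda)\delta_\lambda$ and $\nu=\sum_{\gamma\in\Gamma}\nu(\gamma)\delta_\gamma$, with $\Lambda=\operatorname{supp}\mu$ and $\Gamma=\operatorname{supp}\nu$, come close to infinity if there is a bijection $\sigma:\Lambda\to\Gamma$ such that for every $\varepsilon>0$ and every neighborhood $V$ of $0$ there is a compact $K\subset G$ such that for all $\lambda\in\Lambda$: if $\lambda\in\Lambda\setminus K$ or $\sigma(\lambda)\in\Gamma\setminus K$, then $\lambda-\sigma(\lambda)\in V$ and $|\mu(\lambda)-\nu(\sigma(\lambda))|<\varepsilon$. *)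

(* Defs.v *)
From HB Require Import structures.
From mathcomp Require Import all_boot all_order all_algebra.
From mathcomp Require Import complex.
From mathcomp Require Import all_classical all_reals all_analysis.

Set Implicit Arguments.
Unset Strict Implicit.
Unset Printing Implicit Defensive.

Import Order.TTheory GRing.Theory Num.Theory.
Import numFieldNormedType.Exports.

Local Open Scope classical_set_scope.
Local Open Scope ring_scope.
Local Open Scope complex_scope.

(* [g_sigma_algebraType] needs a pointed carrier; we point groups by [0]. *)
#[non_forgetful_inheritance]
HB.instance Definition _ (G : topologicalZmodType) := isPointed.Build G 0.

(* [`|z|] is itself an element of [R[i]]. *)
Definition cabs (R : realType) (z : R[i]) : R := complex.Re `|z|.

(* [R[i]^o] is [R[i]] with the topology of its norm. *)
Definition ccontinuous (R : realType) (T : topologicalType) (f : T -> R[i]) :=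
  continuous (f : T -> R[i]^o).

Definition sigma_compact (T : topologicalType) (A : set T) :=
  exists2 K : (set T)^nat, (forall n, compact (K n)) & A = \bigcup_n K n.

Section borel.
Context (T : ptopologicalType).

Definition borelType := g_sigma_algebraType (@open T).

Definition borel (A : set T) : Prop := measurable (A : set borelType).

Definition rcborel (A : set T) : Prop := borel A /\ precompact A.

End borel.

Section radon_measures.
Context (R : realType) (T : ptopologicalType).
Implicit Types (mu : set T -> R[i]) (A : set T) (f : T -> R[i]).

(* A complex Radon measure is represented by a total function on sets, of
   which only the values on relatively compact Borel sets are ever used: it
   need not have finite total variation, so it has no value on other sets. *)

(* For Borel [A] that is not relatively compact, this is the value at [A] of
   the (possibly infinite) extension of the variation. *)
Definition mvariation mu A : \bar R :=
  ereal_sup [set (\sum_(0 <= k <oo) (cabs (mu (F k)))%:E)%E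
    | F in [set F : (set T)^nat |
        [/\ forall k, rcborel (F k), forall k, F k `<=` A
          & trivIset setT F]]].

Record radon_measure mu : Prop := RadonMeasure {
  radon_sigma_additive : forall F : (set T)^nat,
    (forall k, rcborel (F k)) -> trivIset setT F -> rcborel (\bigcup_k F k) ->
    (fun n => \sum_(0 <= k < n) mu (F k) : R[i]^o) @ \oo
      --> (mu (\bigcup_k F k) : R[i]^o) ;
  radon_finite : forall K, compact K -> (mvariation mu K < +oo)%E ;
  radon_inner_regular : forall (e : R) A, 0 < e -> rcborel A ->
    exists K, [/\ compact K, K `<=` A & (mvariation mu (A `\` K) < e%:E)%E] }.

(* Jordan decomposition of a real set function [s] known on relatively compact
   Borel sets: [s^+(A)] is the supremum of [s] over the subsets of [A]. *)
Definition pos_part (s : set T -> R) (A : set (borelType T)) : \bar R :=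
  ereal_sup [set (s B)%:E | B in [set B | rcborel B /\ B `<=` A]].

Definition neg_part (s : set T -> R) : set (borelType T) -> \bar R :=
  pos_part (fun A => - s A).

Definition Cintegral (m : set (borelType T) -> \bar R) f : R[i] :=
  fine (\int[m]_x (complex.Re (f x))%:E) +i*
  fine (\int[m]_x (complex.Im (f x))%:E).

(* The integral of [f] against the complex measure [mu], where
   mu = (Re mu)^+ - (Re mu)^- + i ((Im mu)^+ - (Im mu)^-). *)
Definition pairing mu f : R[i] :=
  (Cintegral (pos_part (fun A => complex.Re (mu A))) f -
   Cintegral (neg_part (fun A => complex.Re (mu A))) f) +
  (0 +i* 1) *
  (Cintegral (pos_part (fun A => complex.Im (mu A))) f -
   Cintegral (neg_part (fun A => complex.Im (mu A))) f).

Definition CL1 (m : set (borelType T) -> \bar R) f : Prop :=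
  [/\ measurable_fun [set: borelType T] (fun x => complex.Re (f x)),
      measurable_fun [set: borelType T] (fun x => complex.Im (f x))
    & (\int[m]_x (cabs (f x))%:E < +oo)%E].

Definition msupport mu : set T :=
  [set x | forall U, open_nbhs x U -> (0 < mvariation mu U)%E].

(* [mu] is the sum of the point masses [c k] at [x k]. A countable family is
   enough on a sigma-compact space; atoms may accumulate, and repetitions and
   null coefficients are allowed. *)
Definition pure_point mu : Prop :=
  exists (x : T^nat) (c : R[i]^nat), forall A, rcborel A ->
    (fun n => \sum_(0 <= k < n) c k * \1_A (x k) : R[i]^o) @ \oo
      --> (mu A : R[i]^o).

End radon_measures.

Section group.
Context (R : realType) (G : topologicalZmodType).
Implicit Types (mu nu : set G -> R[i]) (f g : G -> R[i]).

Definition translate (x : G) (A : set G) : set G := [set x + y | y in A].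

Definition discrete_measure mu : Prop :=
  forall x, msupport mu x -> exists2 U, nbhs 0 U &
    translate x U `&` msupport mu = [set x].

Record class_DM mu : Prop := ClassDM {
  DM_radon : radon_measure mu ;
  DM_discrete : discrete_measure mu ;
  DM_finite_density : exists2 U : set G, nbhs 0 U &
    exists N : nat, forall x, (translate x U `&` msupport mu #<= `I_N)%card }.

Definition translation_bounded mu : Prop :=
  forall K : set G, compact K ->
    (ereal_sup [set mvariation mu (translate t K) | t in [set: G]] < +oo)%E.

Definition close_to_infinity mu nu : Prop :=
  exists2 sigma : G -> G, set_bij (msupport mu) (msupport nu) sigma &
    forall (e : R) (V : set G), 0 < e -> nbhs 0 V ->
    exists2 K : set G, compact K &
      forall x, msupport mu x -> ~ K x \/ ~ K (sigma x) ->
        V (x - sigma x) /\ cabs (mu [set x] - nu [set sigma x]) < e.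

Record haar_measure (m : {measure set (borelType G) -> \bar R}) : Prop :=
  HaarMeasure {
  haar_finite : forall K : set G, compact K -> (m K < +oo)%E ;
  haar_inner_regular : forall (e : R) (A : set G), 0 < e -> rcborel A ->
    exists K : set G, [/\ compact K, K `<=` A & (m (A `\` K) < e%:E)%E] ;
  haar_invariant : forall x (A : set G), borel A -> m (translate x A) = m A ;
  haar_neq0 : m [set: G] != 0%E }.

Definition Cc f : Prop :=
  ccontinuous f /\ compact (closure [set x | f x != 0]).

Variable m : {measure set (borelType G) -> \bar R}.

Definition convolution f g (x : G) : R[i] :=
  Cintegral m (fun y : G => f y * g (x - y)).

Definition K2 g : Prop :=
  exists (n : nat) (c : 'I_n -> R[i]) (f1 f2 : 'I_n -> G -> R[i]),
    (forall i, Cc (f1 i) /\ Cc (f2 i)) /\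
    g = (fun x => \sum_(i < n) c i * convolution (f1 i) (f2 i) x).

End group.

Record character (R : realType) (G : topologicalZmodType) := Character {
  char_fun :> G -> R[i] ;
  char_continuous : ccontinuous char_fun ;
  char_unitary : forall x, cabs (char_fun x) = 1 ;
  char_add : forall x y, char_fun (x + y) = char_fun x * char_fun y }.

Section dual.
Context (R : realType) (G : topologicalZmodType).
Local Notation dual := (character R G).

HB.instance Definition _ := gen_eqMixin dual.
HB.instance Definition _ := gen_choiceMixin dual.
(* The dual group carries the topology of compact convergence. *)
HB.instance Definition _ := Topological.copy dual
  (initial_topology (@char_fun R G : dual -> {compact-open, G -> R[i]^o})).

Fact char1_continuous : ccontinuous (fun _ : G => 1 : R[i]).
Proof. by move=> x; exact: cvg_cst. Qed.

Fact char1_unitary (x : G) : cabs (1 : R[i]) = 1.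
Proof. by rewrite /cabs normr1. Qed.

Fact char1_add (x y : G) : (1 : R[i]) = 1 * 1.
Proof. by rewrite mulr1. Qed.

Definition char1 : dual :=
  @Character R G (fun=> 1) char1_continuous char1_unitary char1_add.

HB.instance Definition _ := isPointed.Build dual char1.

Variable m : {measure set (borelType G) -> \bar R}.

(* [m] is the chosen Haar measure. *)
Definition fourier (f : G -> R[i]) (chi : dual) : R[i] :=
  Cintegral m (fun x : G => f x * (chi x)^*).

Definition inverse_fourier (f : G -> R[i]) (chi : dual) : R[i] :=
  Cintegral m (fun x : G => f x * chi x).

Record fourier_transform (mu : set G -> R[i]) (muhat : set dual -> R[i]) :
    Prop := FourierTransform {
  ft_radon : radon_measure muhat ;
  ft_pairing : forall g, K2 m g ->
    pairing mu g = pairing muhat (inverse_fourier g) ;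
  ft_integrable : forall g, K2 m g -> CL1 (mvariation muhat) (fourier g) }.

End dual.

(* Main.v *)
Require Import Defs.
From mathcomp Require Import all_boot all_order all_algebra.
From mathcomp Require Import complex.
From mathcomp Require Import all_classical all_reals all_analysis.
From mathcomp Require Import measurable_realfun.
From mathcomp Require Import ring lra.
Import Order.TTheory GRing.Theory Num.Theory.
Import numFieldNormedType.Exports.
Local Open Scope classical_set_scope.
Local Open Scope ring_scope.
Local Open Scope complex_scope.

(** The theorem is an application of almost periodicity. Fix a test function
    [g], and pair a measure with the translates of [g]; this gives a function of
    the translation parameter [t].

    On the dual side, translating [g] by [t] multiplies its transform by
    [chi t]. Since the Fourier transform of the measure is a sum of point masses
    for which the transform of [g] is integrable, the pairing is an absolutely
    convergent series of characters evaluated at [t]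
    ([transform_almost_periodic]). For a noncompact group, finitely many
    characters have common almost periods outside any given compact set
    ([almost_period], a pigeonhole argument); hence two such series whose
    difference tends to zero at infinity coincide everywhere
    ([almost_periodic_vanishing]).

    On the side of the group, the pairing is a finite sum over the points of the
    support that are met by the translate, and their number is bounded when [g]
    has small support. If two measures come close to infinity, matching their
    points shows that the difference of the two pairings tends to zero at
    infinity ([test_vanishing]). Hence the pairings agree for every [t]. Taking
    for [g] an autocorrelation supported near the origin and positive there
    ([test_function]), centred at a point [p] and so narrow that it sees no
    other point of the supports ([pairing_isolated]), one reads off that the two
    measures have the same mass at [p]. Equality of all point masses is equality
    of the measures ([measure_eq_of_atoms]).

    Both descriptions of the pairing rest on one computation: for a measure with
    countably many distinct atoms the Jordan parts are weighted sums of point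
    masses ([pos_part_atoms]), so that the pairing is a series over the atoms
    ([pairing_atomic]). A discrete measure is of this form because it is carried
    by its support ([concentrated_on_support]), which is countable; a pure point
    measure is by merging repeated atoms ([concentrated_atomic]). *)

Set Implicit Arguments.
Unset Strict Implicit.
Unset Printing Implicit Defensive.

(** * Complex moduli and convergence of complex functions *)

Section complex_modulus.
Context (R : realType).
Implicit Types z w : R[i].
Local Notation Re := complex.Re.
Local Notation Im := complex.Im.

Lemma cabsE z : cabs z = Num.sqrt (Re z ^+ 2 + Im z ^+ 2).
Proof. by rewrite /cabs normc_def. Qed.

Lemma normr_cabs z : `|z| = (cabs z)%:C.
Proof. by rewrite cabsE normc_def. Qed.

Lemma cabs_ge0 z : 0 <= cabs z.
Proof. by rewrite cabsE sqrtr_ge0. Qed.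

Lemma cabs0 : cabs (0 : R[i]) = 0.
Proof. by rewrite /cabs normr0. Qed.

Lemma cabsM z w : cabs (z * w) = cabs z * cabs w.
Proof. by apply: complexI; rewrite rmorphM/= -!normr_cabs normrM. Qed.

Lemma ler_cabsD z w : cabs (z + w) <= cabs z + cabs w.
Proof. by rewrite -lecR rmorphD/= -!normr_cabs ler_normD. Qed.

Lemma cabs_sum_le (I : Type) (r : seq I) (P : pred I) (F : I -> R[i]) :
  cabs (\sum_(i <- r | P i) F i) <= \sum_(i <- r | P i) cabs (F i).
Proof.
elim/big_rec2 : _ => [|i y1 y2 _ le12]; first by rewrite cabs0.
by rewrite (le_trans (ler_cabsD _ _))// lerD2l.
Qed.

Lemma cabsN z : cabs (- z) = cabs z.
Proof. by rewrite /cabs normrN. Qed.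

Lemma cabsJ z : cabs (z^*) = cabs z.
Proof. by rewrite /cabs normcJ. Qed.

Lemma cabs_eq0 z : (cabs z == 0) = (z == 0).
Proof. by rewrite -(inj_eq (@complexI R)) -normr_cabs normr_eq0. Qed.

Lemma ler_Re_cabs z : `|Re z| <= cabs z.
Proof. by rewrite -lecR -normr_cabs normc_ge_Re. Qed.

Lemma ler_Im_cabs z : `|Im z| <= cabs z.
Proof.
rewrite cabsE -sqrtr_sqr ler_wsqrtr// lerDr sqr_ge0//.
Qed.

Lemma cabs_le_ReIm z : cabs z <= `|Re z| + `|Im z|.
Proof.
rewrite cabsE -[leRHS]ger0_norm ?addr_ge0// -sqrtr_sqr ler_wsqrtr//.
rewrite sqrrD !real_normK ?num_real// lerD2r lerDl mulrn_wge0// mulr_ge0.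
Qed.

Lemma cabs_real (r : R) : cabs (r%:C) = `|r|.
Proof. by rewrite cabsE/= expr0n/= addr0 sqrtr_sqr. Qed.

Lemma ReM z w : Re (z * w) = Re z * Re w - Im z * Im w.
Proof. by case: z w => [a b] [c d]. Qed.

Lemma ImM z w : Im (z * w) = Re z * Im w + Im z * Re w.
Proof. by case: z w => [a b] [c d]. Qed.

Lemma ReD z w : Re (z + w) = Re z + Re w.
Proof. by case: z w => [a b] [c d]. Qed.

Lemma ImD z w : Im (z + w) = Im z + Im w.
Proof. by case: z w => [a b] [c d]. Qed.

Lemma ReB z w : Re (z - w) = Re z - Re w.
Proof. by case: z w => [a b] [c d]. Qed.

Lemma ImB z w : Im (z - w) = Im z - Im w.
Proof. by case: z w => [a b] [c d]. Qed.

Lemma Re_sum (I : Type) (r : seq I) (P : pred I) (F : I -> R[i]) :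
  Re (\sum_(i <- r | P i) F i) = \sum_(i <- r | P i) Re (F i).
Proof. by elim/big_rec2 : _ => // i y1 y2 _ <-; rewrite ReD. Qed.

Lemma Im_sum (I : Type) (r : seq I) (P : pred I) (F : I -> R[i]) :
  Im (\sum_(i <- r | P i) F i) = \sum_(i <- r | P i) Im (F i).
Proof. by elim/big_rec2 : _ => // i y1 y2 _ <-; rewrite ImD. Qed.

Lemma cvg_cabsP (T : Type) (F : set_system T) (FF : Filter F)
    (f : T -> R[i]) l :
  ((f : T -> R[i]^o) @ F --> (l : R[i]^o)) <->
  (forall e : R, 0 < e -> \forall x \near F, cabs (l - f x) < e).
Proof.
split => [/cvgrPdist_lt fl e e0|fl].
  have := fl e%:C; rewrite ltcR => /(_ e0); apply: filterS => x.
  by rewrite normr_cabs ltcR.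
apply/cvgrPdist_lt => -[e e']; rewrite ltcE/= => /andP[/eqP-> e0].
by apply: filterS (fl e e0) => x; rewrite normr_cabs -/(real_complex R e) ltcR.
Qed.

Lemma cvg_cabs_le (u : nat -> R[i]) l c :
  (u : nat -> R[i]^o) @ \oo --> (l : R[i]^o) ->
  (\forall n \near \oo, cabs (u n) <= c) -> cabs l <= c.
Proof.
move=> /cvg_cabsP ul uc; apply/ler_addgt0Pr => e e0.
have [n [lun unc]] := filter_ex (filterI (ul _ e0) uc).
rewrite -[X in cabs X](subrK (u n)) (le_trans (ler_cabsD _ _))// addrC lerD//.
exact: ltW.
Qed.

Lemma cvg_ReImP (T : Type) (F : set_system T) (FF : Filter F)
    (f : T -> R[i]) l :
  ((f : T -> R[i]^o) @ F --> (l : R[i]^o)) <->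
  ((fun x => Re (f x)) @ F --> Re l) /\ ((fun x => Im (f x)) @ F --> Im l).
Proof.
rewrite cvg_cabsP; split=> [fl|[rl il] e e0].
  split; apply/cvgrPdist_lt => e /fl; apply: filterS => x; apply: le_lt_trans.
    by rewrite -ReB ler_Re_cabs.
  by rewrite -ImB ler_Im_cabs.
have e20 : 0 < e / 2 by rewrite divr_gt0.
move/cvgrPdist_lt : rl => /(_ _ e20) rl.
move/cvgrPdist_lt : il => /(_ _ e20) il.
apply: filterS2 rl il => x /= rl il.
by rewrite (le_lt_trans (cabs_le_ReIm _))// ReB ImB [ltRHS]splitr ltrD.
Qed.

Lemma ccontinuous_ReImP (T : topologicalType) (f : T -> R[i]) :
  ccontinuous f <->
  continuous (fun x => Re (f x)) /\ continuous (fun x => Im (f x)).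
Proof.
split => [cf|[rf imf] x].
  by split => x; have /cvg_ReImP[] := cf x.
by apply/cvg_ReImP; split; [exact: rf|exact: imf].
Qed.

End complex_modulus.

(** * Integration against weighted sums of point masses *)

Import HBNNSimple.

(** The integral evaluates its set function at measurable sets only. Variations
    and Jordan parts are plain set functions, not bundled measures; this lets
    them be replaced by measures that agree with them on Borel sets. *)
Lemma eq_set_function_integral d (T : measurableType d) (R : realType)
    (m1 m2 : set T -> \bar R) (f : T -> \bar R) :
  (forall A, measurable A -> m1 A = m2 A) ->
  (\int[m1]_x f x = \int[m2]_x f x)%E.
Proof.
move=> m12.
have sint (h : {nnsfun T >-> R}) :
    sintegral m1 h = sintegral m2 h.
  by apply: eq_fsbigr => r _; rewrite m12.
rewrite /integral; congr (ereal_sup _ - ereal_sup _)%E;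
  by apply/seteqP; split => _ [h hf <-]; exists h.
Qed.

Lemma cvg_fine_nneseries (R : realType) (u : nat -> R) : (forall k, 0 <= u k) ->
  (\sum_(0 <= k <oo) (u k)%:E < +oo)%E ->
  series u @ \oo --> fine (\sum_(0 <= k <oo) (u k)%:E)%E.
Proof.
move=> u0 uoo; have cu := nnseries_is_cvg u0 uoo.
rewrite (_ : (fun n => _) = EFin \o series u) ?EFin_lim//.
by apply/funext => n; rewrite /series/= sumEFin.
Qed.

Section weighted_diracs.
Context d (T : measurableType d) (R : realType).
Variables (w : nat -> R) (w_ge0 : forall k, 0 <= w k) (e : nat -> T).

Definition weighted_diracs : {measure set T -> \bar R} :=
  mseries (fun k => mscale (NngNum (w_ge0 k)) (dirac (e k))) 0.

Lemma weighted_diracsE A :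
  weighted_diracs A = (\sum_(0 <= k <oo) (w k * \1_A (e k))%:E)%E.
Proof. by []. Qed.

Lemma ge0_integral_weighted_diracs (f : T -> \bar R) :
  measurable_fun setT f -> (forall x, 0 <= f x)%E ->
  (\int[weighted_diracs]_x f x = \sum_(0 <= k <oo) (w k)%:E * f (e k))%E.
Proof.
move=> mf f0; rewrite ge0_integral_measure_series//.
apply: eq_eseriesr => k _; rewrite ge0_integral_mscale//.
by rewrite integral_dirac//= diracT mul1e.
Qed.

(** Stated as a convergence of real partial sums, so that the positive and the
    negative parts of [h] can be treated separately and then subtracted. *)
Lemma integral_weighted_diracs (h : T -> R) : measurable_fun setT h ->
  (\sum_(0 <= k <oo) (w k * `|h (e k)|)%:E < +oo)%E ->
  (fun n => \sum_(0 <= k < n) w k * h (e k)) @ \oo -->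
  fine (\int[weighted_diracs]_x (h x)%:E)%E.
Proof.
move=> mh hoo.
have part (g : T -> R) : measurable_fun setT g ->
    (forall x, 0 <= g x <= `|h x|) ->
    (\int[weighted_diracs]_x (g x)%:E < +oo)%E /\
    (fun n => \sum_(0 <= k < n) w k * g (e k)) @ \oo -->
      fine (\int[weighted_diracs]_x (g x)%:E)%E.
  move=> mg g0h.
  have g0 x : 0 <= g x by have /andP[] := g0h x.
  rewrite ge0_integral_weighted_diracs; first last.
  - by move=> x; rewrite lee_fin.
  - exact/measurable_EFinP.
  have goo : (\sum_(0 <= k <oo) (w k * g (e k))%:E < +oo)%E.
    apply: le_lt_trans hoo; apply: lee_nneseries => k *.
      by rewrite lee_fin mulr_ge0.
    by rewrite lee_fin ler_wpM2l//; have /andP[] := g0h (e k).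
  by split=> //; apply: cvg_fine_nneseries goo => k; rewrite mulr_ge0.
have mhp : measurable_fun setT (h^\+) by exact: measurable_funrpos.
have mhn : measurable_fun setT (h^\-) by exact: measurable_funrneg.
have le_norm (x : R) : x <= `|x| /\ - x <= `|x|.
  by rewrite ler_norm -normrN ler_norm.
have [|poo cp] := part _ mhp.
  move=> x; rewrite funrpos_ge0/= ge_max normr_ge0 andbT.
  by have [] := le_norm (h x).
have [|noo cn] := part _ mhn.
  move=> x; rewrite funrneg_ge0/= ge_max normr_ge0 andbT.
  by have [] := le_norm (h x).
have fin (g : T -> R) : (forall x, 0 <= g x) ->
    (\int[weighted_diracs]_x (g x)%:E < +oo)%E ->
    (\int[weighted_diracs]_x (g x)%:E)%E \is a fin_num.
  move=> g0 goo; rewrite ge0_fin_numE// integral_ge0// => x _.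
  by rewrite lee_fin.
rewrite integralE funerpos funerneg fineB; [|exact: fin poo|exact: fin noo].
apply: cvg_trans (cvgB cp cn); apply: near_eq_cvg; near=> n => /=.
rewrite fctE -sumrB; apply: eq_bigr => k _.
by rewrite -mulrBr -[in RHS](funrposBneg h).
Unshelve. all: by end_near. Qed.

End weighted_diracs.

(** * Relatively compact Borel sets and Jordan parts *)

Section rcborel_sets.
Context (T : ptopologicalType).
Implicit Types A B : set T.

Lemma open_borel A : open A -> borel A.
Proof. exact: sub_sigma_algebra. Qed.

Lemma closed_borel A : closed A -> borel A.
Proof.
move=> cA; rewrite /borel -[A]setCK.
apply: (@measurableC _ (borelType T)).
by apply: open_borel; exact: closed_openC.
Qed.

Lemma rcborelI A B : rcborel A -> borel B -> rcborel (A `&` B).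
Proof.
move=> [bA pA] bB; split; first exact: (@measurableI _ (borelType T)).
by apply: precompact_subset pA => x [].
Qed.

Lemma rcborel_finite A : accessible_space T -> finite_set A -> rcborel A.
Proof.
move=> /accessible_finite_set_closed cT fA; split.
  by apply: closed_borel; exact: cT.
by rewrite precompact_closed; [exact: finite_compact|exact: cT].
Qed.

End rcborel_sets.

Section partial_sums.
Context (R : realType).

Lemma cvg_cst_eq (K : numFieldType) (V : normedModType K) (u : nat -> V)
    (l l' : V) N :
  (forall n, (N <= n)%N -> u n = l) -> u @ \oo --> l' -> l' = l.
Proof.
move=> ul ul'; apply: (@cvg_unique _ _ (u @ \oo)) => //.
by apply: cvg_near_cst; exists N => // n; exact: ul.
Qed.

Lemma cvg_series_le (u v : nat -> R) (l : R) : (forall k, u k <= v k) ->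
  (forall k, 0 <= v k) ->
  (fun n => \sum_(0 <= k < n) u k) @ \oo --> l ->
  (l%:E <= \sum_(0 <= k <oo) (v k)%:E)%E.
Proof.
move=> uv v0 ul.
have le_oo n : ((\sum_(0 <= k < n) u k)%:E <= \sum_(0 <= k <oo) (v k)%:E)%E.
  apply: (@le_trans _ _ (\sum_(0 <= k < n) (v k)%:E)%E).
    by rewrite sumEFin lee_fin ler_sum.
  by apply: nneseries_lim_ge => k *; rewrite lee_fin.
case: (\sum_(0 <= k <oo) _)%E le_oo => [r| |] le_r; rewrite ?leey//.
  rewrite lee_fin; apply: (cvgr_to_le ul); near=> n.
  by rewrite -lee_fin le_r.
by have := le_r 0%N.
Unshelve. all: by end_near. Qed.

End partial_sums.

(** Null weights are exempt: a finite family of atoms can then be padded to a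
    sequence. *)
Definition distinct_atoms (T : Type) (K : nmodType)
    (e : nat -> T) (a : nat -> K) :=
  forall j k, a j != 0 -> a k != 0 -> e j = e k -> j = k.

Section real_atoms.
Context (R : realType) (T : ptopologicalType).
Hypothesis T1 : accessible_space T.
Variables (s : set T -> R) (e : nat -> T) (b : nat -> R).
Hypothesis e_distinct : distinct_atoms e b.
Hypothesis s_sum : forall B, rcborel B ->
  (fun n => \sum_(0 <= k < n) b k * \1_B (e k)) @ \oo --> s B.

(** The supremum defining the positive part is approached by the finite sets of
    atoms of positive weight. Since atoms are not repeated, no cancellation
    takes place inside an atom, and the weight of such a set is the sum of the
    positive weights that it collects. *)
Lemma pos_part_atoms (A : set T) : borel A ->
  pos_part s A =
  weighted_diracs (fun k => funrpos_ge0 b k) (e : nat -> borelType T) A.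
Proof.
move=> bA; rewrite weighted_diracsE.
have term_ge0 k : 0 <= b^\+ k * \1_A (e k) by rewrite mulr_ge0 ?funrpos_ge0.
have {}term_ge0 k : (0 <= (b^\+ k * \1_A (e k))%:E)%E by rewrite lee_fin.
apply/eqP; rewrite eq_le; apply/andP; split.
  apply: ge_ereal_sup => _ [B [rB BA] <-].
  apply: cvg_series_le (s_sum rB) => k; last by rewrite -lee_fin.
  rewrite (le_trans (y := b^\+ k * \1_B (e k)))//.
    by rewrite ler_wpM2r// /funrpos le_max lexx.
  rewrite ler_wpM2l ?funrpos_ge0// !indicE.
  by case: (boolP (e k \in B)) => // /set_mem/BA/mem_set->.
apply: lime_le; first by apply: is_cvg_nneseries => k *.
near=> n.
(* the positive atoms of [A] among the first [n] *)
pose B := [set e k | k in [set k | [/\ (k < n)%N, A (e k) & 0 < b k]]].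
have BA : B `<=` A by move=> _ [k [_ ? _] <-].
have rB : rcborel B.
  apply: rcborel_finite => //; apply: finite_image.
  by apply: sub_finite_set (finite_II n) => k [].
have memB k : b k != 0 -> B (e k) -> [/\ (k < n)%N, A (e k) & 0 < b k].
  move=> bk [j [jn Aj bj] ejk].
  by have <- : j = k by apply: e_distinct => //; exact: lt0r_neq0.
have term0 k : ~ [/\ (k < n)%N, A (e k) & 0 < b k] -> b k * \1_B (e k) = 0.
  move=> nk; have [->|bk] := eqVneq (b k) 0; first by rewrite mul0r.
  by rewrite indicE memNset ?mulr0// => /(memB _ bk).
have term k : (k < n)%N -> b k * \1_B (e k) = b^\+ k * \1_A (e k).
  move=> kn; have [[Aek bk]|nk] := pselect (A (e k) /\ 0 < b k).
    by rewrite !indicE !mem_set//; [rewrite /funrpos max_l// ltW|exists k].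
  rewrite term0; last by case=> *; exact: nk.
  have [Aek|nAek] := pselect (A (e k)); last by rewrite indicE memNset ?mulr0.
  rewrite /funrpos max_r ?mul0r// leNgt; apply/negP => bk; exact: nk.
have -> : (\sum_(0 <= k < n) (b^\+ k * \1_A (e k))%:E = (s B)%:E)%E.
  rewrite sumEFin; congr EFin; apply/esym.
  apply: (cvg_cst_eq (N := n)) (s_sum rB) => m nm.
  rewrite (big_cat_nat (n := n))//= [X in _ + X]big_nat_cond.
  rewrite [X in _ + X]big1 ?addr0.
    by apply: eq_big_nat => k /andP[_ kn]; exact: term.
  move=> k /andP[/andP[nk _] _]; apply: term0 => -[kn _ _].
  by rewrite ltnNge nk in kn.
by apply: ereal_sup_ubound; exists B.
Unshelve. all: by end_near. Qed.
End real_atoms.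

(** * Complex measures with countably many atoms *)

Section atomic_measures.
Context (R : realType) (T : ptopologicalType).
Hypothesis T1 : accessible_space T.
Local Notation Re := complex.Re.
Local Notation Im := complex.Im.

(** The reduced form of a pure point measure: as no atom is repeated, the
    weights are the masses of the points. *)
Record atomic_measure (mu : set T -> R[i]) (e : nat -> T) (a : nat -> R[i]) :
    Prop := AtomicMeasure {
  atoms_distinct : distinct_atoms e a ;
  atomic_sum : forall B, rcborel B ->
    (fun n => \sum_(0 <= k < n) a k * \1_B (e k) : R[i]^o) @ \oo
      --> (mu B : R[i]^o) }.

Variables (mu : set T -> R[i]) (e : nat -> T) (a : nat -> R[i]).
Hypothesis mu_atomic : atomic_measure mu e a.

Lemma indic_complex (B : set T) x : \1_B x = (\1_B x : R)%:C :> R[i].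
Proof. by rewrite !indicE; case: (_ \in _). Qed.

Lemma ReM_real (z : R[i]) (r : R) : Re (z * r%:C) = Re z * r.
Proof. by rewrite ReM/= mulr0 subr0. Qed.

Lemma ImM_real (z : R[i]) (r : R) : Im (z * r%:C) = Im z * r.
Proof. by rewrite ImM/= mulr0 add0r. Qed.

Lemma atomic_Re_sum B : rcborel B ->
  (fun n => \sum_(0 <= k < n) Re (a k) * \1_B (e k)) @ \oo --> Re (mu B).
Proof.
move=> /(atomic_sum mu_atomic)/cvg_ReImP[+ _]; apply: cvg_trans.
apply: near_eq_cvg; near=> n; rewrite Re_sum.
by apply: eq_bigr => k _; rewrite indic_complex ReM_real.
Unshelve. all: by end_near. Qed.

Lemma atomic_Im_sum B : rcborel B ->
  (fun n => \sum_(0 <= k < n) Im (a k) * \1_B (e k)) @ \oo --> Im (mu B).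
Proof.
move=> /(atomic_sum mu_atomic)/cvg_ReImP[_]; apply: cvg_trans.
apply: near_eq_cvg; near=> n; rewrite Im_sum.
by apply: eq_bigr => k _; rewrite indic_complex ImM_real.
Unshelve. all: by end_near. Qed.

Lemma atomic_set1 k : a k != 0 -> mu [set e k] = a k.
Proof.
move=> ak; have rek : rcborel [set e k] by exact: rcborel_finite.
apply: (cvg_cst_eq (N := k.+1)) (atomic_sum mu_atomic rek) => n kn.
rewrite big_mkord (bigD1 (Ordinal kn))//= indicE mem_set// mulr1.
rewrite big1 ?addr0// => j jk; have [->|aj] := eqVneq (a j) 0.
  by rewrite mul0r.
rewrite indicE memNset ?mulr0//= => ejk.
by move/eqP : jk; apply; apply/val_inj/(atoms_distinct mu_atomic).
Qed.

Let variation : {measure set (borelType T) -> \bar R} :=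
  weighted_diracs (fun k => cabs_ge0 (a k)) (e : nat -> borelType T).

Lemma cabs_atomic_le B : rcborel B -> ((cabs (mu B))%:E <= variation B)%E.
Proof.
move=> rB.
have le_var n :
    ((cabs (\sum_(0 <= k < n) a k * \1_B (e k)))%:E <= variation B)%E.
  apply: (@le_trans _ _ (\sum_(0 <= k < n) (cabs (a k) * \1_B (e k))%:E)%E).
    rewrite sumEFin lee_fin (le_trans (cabs_sum_le _ _ _))// ler_sum// => k _.
    by rewrite indic_complex cabsM cabs_real ger0_norm.
  by apply: nneseries_lim_ge => k *; rewrite lee_fin mulr_ge0 ?cabs_ge0.
case: (variation B) le_var => [r| |] le_r; rewrite ?leey//; last first.
  by have := le_r 0%N.
rewrite lee_fin; apply: cvg_cabs_le (atomic_sum mu_atomic rB) _.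
by near=> n; rewrite -lee_fin.
Unshelve. all: by end_near. Qed.

(** The variation is attained on the family of singletons of atoms, which is
    disjoint because atoms are not repeated. *)
Lemma mvariation_atomic (A : set T) : borel A -> mvariation mu A = variation A.
Proof.
move=> bA; apply/eqP; rewrite eq_le; apply/andP; split.
  apply: ge_ereal_sup => _ [F [rF FA tF] <-].
  have mF k : measurable (F k : set (borelType T)) by have [] := rF k.
  apply: (@le_trans _ _ (\sum_(0 <= k <oo) variation (F k))%E).
    apply: lee_nneseries => k *; first by rewrite lee_fin cabs_ge0.
    exact: cabs_atomic_le.
  rewrite -measure_semi_bigcup//; last exact: bigcupT_measurable.
  apply: le_measure; rewrite ?inE//; first exact: bigcupT_measurable.
  exact: bigcup_sub.
pose F k := if a k == 0 then set0 else [set e k] `&` A.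
have rF k : rcborel (F k).
  rewrite /F; case: ifP => _; first exact: rcborel_finite.
  by apply: rcborelI => //; exact: rcborel_finite.
apply: ereal_sup_ubound; exists F.
  split => // [k|].
    by rewrite /F; case: ifP => // _ x [].
  apply/trivIsetP => j k _ _ jk; rewrite /F.
  have [_|aj] := eqVneq (a j) 0; first by rewrite set0I.
  have [_|ak] := eqVneq (a k) 0; first by rewrite setI0.
  apply/seteqP; split => // x [[-> _] [ejk _]].
  by move/eqP : jk; apply; exact: (atoms_distinct mu_atomic).
rewrite /variation weighted_diracsE; apply: eq_eseriesr => k _; congr EFin.
have mu0 : mu set0 = 0.
  apply: (cvg_cst_eq (N := 0%N)) (atomic_sum mu_atomic _) => [n _|].
    by rewrite big1// => j _; rewrite indic0 mulr0.
  exact: rcborel_finite.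
rewrite /F; have [->|ak] := eqVneq (a k) 0; first by rewrite mu0 cabs0 mul0r.
have [Aek|nAek] := pselect (A (e k)).
  by rewrite indicE mem_set// mulr1 setIidl ?atomic_set1// => _ ->.
rewrite indicE memNset// mulr0 (_ : _ `&` _ = set0) ?mu0 ?cabs0//.
by apply/seteqP; split => // _ [->].
Qed.

End atomic_measures.

Section pairing_with_atoms.
Context (R : realType) (T : ptopologicalType).
Hypothesis T1 : accessible_space T.
Local Notation Re := complex.Re.
Local Notation Im := complex.Im.

(** The weight [b k] is the difference of its positive part and of the positive
    part of [- b k]; these are the weights of the two Jordan parts. *)
Lemma signed_integral_atoms (s : set T -> R) (e : nat -> T) (b : nat -> R)
    (h : borelType T -> R) :
  distinct_atoms e b ->
  (forall B, rcborel B ->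
    (fun n => \sum_(0 <= k < n) b k * \1_B (e k)) @ \oo --> s B) ->
  measurable_fun [set: borelType T] h ->
  (\sum_(0 <= k <oo) (`|b k| * `|h (e k)|)%:E < +oo)%E ->
  (fun n => \sum_(0 <= k < n) b k * h (e k)) @ \oo -->
  fine (\int[pos_part s]_x (h x)%:E)%E - fine (\int[neg_part s]_x (h x)%:E)%E.
Proof.
move=> ed sb mh hoo.
have pos (s' : set T -> R) (b' : nat -> R) : distinct_atoms e b' ->
    (forall k, b' k <= `|b k|) ->
    (forall B, rcborel B ->
    (fun n => \sum_(0 <= k < n) b' k * \1_B (e k)) @ \oo --> s' B) ->
    (fun n => \sum_(0 <= k < n) b'^\+ k * h (e k)) @ \oo -->
      fine (\int[pos_part s']_x (h x)%:E)%E.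
  move=> ed' bb' sb'.
  rewrite (@eq_set_function_integral _ (borelType T) R _ _ _
    (pos_part_atoms T1 ed' sb')).
  apply: integral_weighted_diracs => //.
  apply: le_lt_trans hoo; apply: lee_nneseries => k *; rewrite lee_fin.
    by rewrite mulr_ge0 ?funrpos_ge0.
  by rewrite ler_wpM2r// /funrpos ge_max bb' normr_ge0.
have edN : distinct_atoms e (- b).
  by move=> j k; rewrite !fctE !oppr_eq0; exact: ed.
have sbN B : rcborel B ->
    (fun n => \sum_(0 <= k < n) (- b) k * \1_B (e k)) @ \oo --> - s B.
  move=> /sb/cvgN; apply: cvg_trans; apply: near_eq_cvg; near=> n.
  by rewrite !fctE -sumrN; apply: eq_bigr => k _; rewrite mulNr.
have bN k : (- b) k <= `|b k| by rewrite -normrN ler_norm.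
apply: cvg_trans (cvgB (pos s b ed (fun k => ler_norm _) sb)
                       (pos (fun B => - s B) _ edN bN sbN)).
apply: near_eq_cvg; near=> n; rewrite fctE -sumrB; apply: eq_bigr => k _.
by rewrite -mulrBl funrposN -[in RHS](funrposBneg b).
Unshelve. all: by end_near. Qed.

(** The four integrals of the pairing against Jordan parts become four
    absolutely convergent series, which recombine into the complex product. *)
Lemma pairing_atomic (mu : set T -> R[i]) e a (f : T -> R[i]) :
  atomic_measure mu e a ->
  measurable_fun [set: borelType T] (fun x => Re (f x)) ->
  measurable_fun [set: borelType T] (fun x => Im (f x)) ->
  (\sum_(0 <= k <oo) (cabs (a k) * cabs (f (e k)))%:E < +oo)%E ->
  (fun n => \sum_(0 <= k < n) a k * f (e k) : R[i]^o) @ \oo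
    --> (pairing mu f : R[i]^o).
Proof.
move=> mu_atomic mRe mIm foo.
have distinct (g : R[i] -> R) : g 0 = 0 -> distinct_atoms e (fun k => g (a k)).
  move=> g0 j k gj gk; apply: (atoms_distinct mu_atomic).
    by apply: contra_neq gj => ->.
  by apply: contra_neq gk => ->.
have summable (g1 g2 : R[i] -> R) : (forall z, `|g1 z| <= cabs z) ->
    (forall z, `|g2 z| <= cabs z) ->
    (\sum_(0 <= k <oo) (`|g1 (a k)| * `|g2 (f (e k))|)%:E < +oo)%E.
  move=> g1a g2f; apply: le_lt_trans foo; apply: lee_nneseries => k *.
    by rewrite lee_fin mulr_ge0.
  by rewrite lee_fin ler_pM.
have lRe := @ler_Re_cabs R; have lIm := @ler_Im_cabs R.
have RR := signed_integral_atoms (distinct (@complex.Re R) erefl)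
  (atomic_Re_sum mu_atomic) mRe (summable _ _ lRe lRe).
have RI := signed_integral_atoms (distinct (@complex.Re R) erefl)
  (atomic_Re_sum mu_atomic) mIm (summable _ _ lRe lIm).
have IR := signed_integral_atoms (distinct (@complex.Im R) erefl)
  (atomic_Im_sum mu_atomic) mRe (summable _ _ lIm lRe).
have II := signed_integral_atoms (distinct (@complex.Im R) erefl)
  (atomic_Im_sum mu_atomic) mIm (summable _ _ lIm lIm).
have transport (u v : nat -> R) l l' : u @ \oo --> l -> u =1 v -> l = l' ->
    v @ \oo --> l'.
  by move=> + /funext <- <-.
apply/cvg_ReImP; split.
  apply: transport (cvgB RR II) _ _ => [n|].
    rewrite Re_sum fctE -sumrB.
    by apply: eq_bigr => k _; rewrite ReM.
  by rewrite /pairing/= mul0r mul1r add0r.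
apply: transport (cvgD RI IR) _ _ => [n|].
  rewrite Im_sum fctE -big_split/=.
  by apply: eq_bigr => k _; rewrite ImM.
by rewrite /pairing/= mul0r mul1r add0r.
Qed.

End pairing_with_atoms.

(** * Measures carried by a countable set *)

Section concentrated_measures.
Context (R : realType) (T : ptopologicalType).
Hypothesis T1 : accessible_space T.
Implicit Types (mu : set T -> R[i]) (A B X : set T).

Lemma countable_borel A : countable A -> borel A.
Proof.
move=> cA; apply: (@countable_measurable _ (borelType T)) => // x.
exact: (@rcborel_finite T [set x] T1 (finite_set1 _)).1.
Qed.

(** A constant series converges only if its term vanishes. *)
Lemma radon_set0 mu : radon_measure mu -> mu set0 = 0.
Proof.
move=> radon_mu; have r0 : rcborel (@set0 T) by exact: rcborel_finite.
have := radon_sigma_additive radon_mu (F := fun=> set0) (fun=> r0).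
rewrite bigcup0// => /(_ _ r0) mu0.
have : (fun _ : nat => mu set0 : R[i]^o) @ \oo --> (0 : R[i]^o).
  apply: cvg_series_cvg_0; apply/cvg_ex; exists (mu set0).
  by apply: mu0; apply/trivIsetP => *; rewrite set0I.
by move=> /(cvg_cst_eq (N := 0%N) (fun _ _ => erefl)).
Qed.

Lemma radonU mu A B : radon_measure mu -> rcborel A -> rcborel B ->
  A `&` B = set0 -> mu (A `|` B) = mu A + mu B.
Proof.
move=> radon_mu rA rB AB0; have mu0 := radon_set0 radon_mu.
pose F k := if k is 0%N then A else if k is 1%N then B else set0.
have rF k : rcborel (F k).
  by case: k => [|[|k]]//=; exact: rcborel_finite.
have tF : trivIset setT F.
  apply/trivIsetP => -[|[|j]] [|[|k]] _ _ //= _;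
    by rewrite ?set0I ?setI0// setIC.
have FE : \bigcup_k F k = A `|` B.
  apply/seteqP; split => [x [[|[|k]]//= _ Fx]|x [Ax|Bx]];
    [by left|by right|by exists 0%N|by exists 1%N].
have rAB : rcborel (A `|` B).
  case: rA rB => bA pA [bB pB]; split.
    exact: (@measurableU _ (borelType T)).
  by move: pA pB; rewrite !precompactE closureU; exact: compactU.
have := radon_sigma_additive radon_mu rF tF; rewrite FE => /(_ rAB) FAB.
apply: (cvg_cst_eq (N := 2)) FAB => -[|[|n]]// _.
rewrite big_nat_recl// big_nat_recl//= big1 ?addr0// => k _.
Qed.

Lemma cabs_le_mvariation mu A B : radon_measure mu -> rcborel A -> A `<=` B ->
  ((cabs (mu A))%:E <= mvariation mu B)%E.
Proof.
move=> radon_mu rA AB.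
pose F k := if k is 0%N then A else set0.
have rF k : rcborel (F k).
  by case: k => [|k]//=; exact: rcborel_finite.
apply: (@le_trans _ _ (\sum_(0 <= k <oo) (cabs (mu (F k)))%:E)%E).
  apply: le_trans (nneseries_lim_ge 1 _); first by rewrite big_nat1.
  by move=> *; rewrite lee_fin cabs_ge0.
apply: ereal_sup_ubound; exists F => //; split => // [[|k]//=|].
by apply/trivIsetP => -[|j] [|k] _ _ //= _; rewrite ?set0I ?setI0.
Qed.

(** An injection [r] of [X] into the integers cuts [X] into singletons; applying
    countable additivity to this partition gives the weights. The enumeration
    depends on [X] alone, so that two measures carried by [X] can be compared
    weight by weight. *)
Lemma concentrated_atomic X : countable X ->
  exists (e : nat -> T) (r : T -> nat), forall mu, radon_measure mu ->
  (forall B, rcborel B -> mu B = mu (B `&` X)) ->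
  exists a : nat -> R[i], [/\ atomic_measure mu e a,
      forall k, a k != 0 -> X (e k) /\ r (e k) = k &
      forall x, X x -> e (r x) = x /\ a (r x) = mu [set x]].
Proof.
move=> cX; have /countable_injP[r r_inj] := cX.
pose F k := X `&` r @^-1` [set k].
pose e k := xget point (F k).
have Fe k x : F k x -> F k = [set x] /\ e k = x.
  move=> [Xx rxk]; have Fx : F k = [set x].
    apply/seteqP; split => [y [Xy ryk]|_ ->//].
    by apply: r_inj; rewrite ?inE//= ryk rxk.
  split => //; have : F k (e k) by apply: xgetPex; exists x; rewrite Fx.
  by rewrite Fx.
have FP k : F k = set0 \/ [/\ F k = [set e k], X (e k) & r (e k) = k].
  have [[x Fkx]|F0] := pselect (F k !=set0).
    by right; have [Fx ->] := Fe _ _ Fkx; case: Fkx.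
  by left; apply/seteqP; split=> // x Fkx; apply: F0; exists x.
have rF k : rcborel (F k).
  by apply: rcborel_finite => //; case: (FP k) => [->|[-> _ _]].
exists e, r => mu radon_mu muX; have mu0 := radon_set0 radon_mu.
pose a k := mu (F k).
have aP k : a k != 0 -> X (e k) /\ r (e k) = k.
  by rewrite /a; case: (FP k) => [->|[_]//]; rewrite mu0 eqxx.
have FX : \bigcup_k F k = X.
  apply/seteqP; split => [x [k _ []//]|x Xx]; by exists (r x).
exists a; split => //; last first.
  move=> x Xx; have [Fx ->] : F (r x) = [set x] /\ e (r x) = x by exact: Fe.
  by rewrite /a Fx.
split => [j k /aP[_ rj] /aP[_ rk] ejk|B rB]; first by rewrite -rj ejk.
have rFB k : rcborel (F k `&` B) by apply: rcborelI => //; case: rB.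
have BX : \bigcup_k (F k `&` B) = B `&` X by rewrite -setI_bigcupl FX setIC.
have tFB : trivIset setT (fun k => F k `&` B).
  by apply/trivIsetP => j k _ _ jk; apply/seteqP; split => // x
    [[[_ /= rj] _] [[_ /= rk] _]]; move/eqP : jk; rewrite -rj -rk.
have rBX : rcborel (B `&` X) by apply: rcborelI => //; exact: countable_borel.
rewrite muX// -BX; have := radon_sigma_additive radon_mu rFB tFB.
rewrite BX => /(_ rBX); apply: cvg_trans; apply: near_eq_cvg; near=> n.
apply: eq_bigr => k _; rewrite /a.
case: (FP k) => [->|[Fk _ _]]; first by rewrite set0I mu0 mul0r.
have [Bek|nBek] := pselect (B (e k)).
  by rewrite indicE mem_set// mulr1 Fk setIidl// => _ ->.
rewrite indicE memNset// mulr0 Fk (_ : _ `&` _ = set0) ?mu0//.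
by apply/seteqP; split => // _ [->].
Unshelve. all: by end_near. Qed.

End concentrated_measures.

(** * Supports in second countable spaces *)

Section supports.
Context (R : realType) (T : ptopologicalType).
Hypothesis T1 : accessible_space T.
Implicit Types (mu : set T -> R[i]) (A B X : set T).

(** Intersecting a set with the range of the atoms does not change any partial
    sum. *)
Lemma pure_point_concentrated mu : pure_point mu ->
  exists2 X, countable X & forall B, rcborel B -> mu B = mu (B `&` X).
Proof.
move=> [x [c mu_sum]].
have cx : countable (range x) by apply: sub_countable (card_image_le _ _) _.
exists (range x) => // B rB.
have rBX : rcborel (B `&` range x).
  by apply: rcborelI => //; exact: countable_borel.
apply: (@cvg_unique R[i]^o _
  ((fun n => \sum_(0 <= k < n) c k * \1_B (x k) : R[i]^o) @ \oo)) => //.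
  exact: mu_sum.
apply: cvg_trans (mu_sum _ rBX); apply: near_eq_cvg; near=> n.
apply: eq_bigr => k _; congr (_ * _); rewrite !indicE.
congr (_%:R); congr (nat_of_bool _); apply/idP/idP => /set_mem => [[Bx _]|Bx].
  exact: mem_set.
by apply: mem_set; split => //; exists k.
Unshelve. all: by end_near. Qed.

Lemma closed_msupport mu : closed (msupport mu).
Proof.
rewrite -[msupport mu]setCK; apply: open_closedC.
rewrite openE => x /existsNP[U] /not_implyP[[oU Ux] U0].
by rewrite /interior nbhsE; exists U => // y Uy /(_ U) sU; exact/U0/sU.
Qed.

Lemma le_mvariation mu A B : A `<=` B -> (mvariation mu A <= mvariation mu B)%E.
Proof.
move=> AB; apply: le_ereal_sup => _ [F [rF FA tF] <-]; exists F => //.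
by split => // k; exact: subset_trans (FA k) AB.
Qed.

(** The Lindelof property for covers by open sets with a hereditary
    property. *)
Lemma countable_open_cover (P : set T -> Prop) B : second_countable (T := T) ->
  (forall U W, W `<=` U -> P U -> P W) ->
  (forall x, B x -> exists2 U, open_nbhs x U & P U) ->
  exists V : (set T)^nat, [/\ forall k, open (V k),
    forall k, V k = set0 \/ P (V k) & B `<=` \bigcup_k V k].
Proof.
move=> [base cbase [base_open base_nbhs]] subP BP.
have /countable_injP[f f_inj] := cbase.
(* the k-th basic open set in P, empty when there is none of index k *)
pose V k := [set x | exists U, [/\ base U /\ P U, f U = k & U x]].
have VE k : V k = set0 \/ base (V k) /\ P (V k).
  have [[x [U [nU fU Ux]]]|V0] := pselect (V k !=set0); last first.
    by left; apply/seteqP; split => // x Vx; apply: V0; exists x.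
  right; rewrite (_ : V k = U)//.
  apply/seteqP; split => [y|y Uy]; last by exists U.
  move=> [W [[bW _] fW Wy]]; rewrite (_ : U = W)//.
  by apply: f_inj; rewrite ?inE// ?fU//; case: nU.
exists V; split => [k|k|x Bx].
- by case: (VE k) => [->|[/base_open//]]; exact: open0.
- by case: (VE k) => [|[]]; [left|right].
- have [U xU PU] := BP x Bx.
  have [W [bW Wx] WU] := base_nbhs x U (open_nbhs_nbhs xU).
  by exists (f W) => //; exists W; split => //; split => //; exact: subP PU.
Qed.

(** Off the support, every point has an open neighborhood of zero variation, and
    countably many of them suffice; the disjoint pieces that they cut are
    null. *)
Lemma measure_off_support mu B : second_countable (T := T) ->
  radon_measure mu -> rcborel B -> B `&` msupport mu = set0 -> mu B = 0.
Proof.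
move=> sT radon_mu rB Bsupp; have mu0 := radon_set0 T1 radon_mu.
have [||V [oV VE BV]] := @countable_open_cover
    (fun U => ~ (0 < mvariation mu U)%E) B sT.
- move=> U W WU; apply: contra_not => /lt_le_trans; apply.
  exact: le_mvariation.
- move=> x Bx; have : ~ msupport mu x.
    by move=> sx; have : (B `&` msupport mu) x by []; rewrite Bsupp.
  by move=> /existsNP[U] /not_implyP[xU U0]; exists U.
have bV k : borel (V k) by exact: open_borel.
pose F k := B `&` seqDU V k.
have rF k : rcborel (F k).
  apply: rcborelI => //; apply: (@measurableD _ (borelType T)).
    exact: bV.
  by apply: (@bigsetU_measurable _ (borelType T)) => j _; exact: bV.
have FE : \bigcup_k F k = B.
  by rewrite -setI_bigcupr -seqDU_bigcup_eq; apply: setIidl.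
have F0 k : mu (F k) = 0.
  have FV : F k `<=` V k by move=> x [_ []].
  case: (VE k) => [V0|/negP nV].
    by rewrite (_ : F k = set0)//; move: FV; rewrite V0 subset0.
  apply/eqP; rewrite -cabs_eq0 eq_le cabs_ge0 andbT -lee_fin.
  rewrite (le_trans (cabs_le_mvariation T1 radon_mu (rF k) FV))//.
  by rewrite leNgt.
have := radon_sigma_additive radon_mu rF; rewrite FE => /(_ _ rB) muF.
apply: (cvg_cst_eq (N := 0%N)) (muF _) => [n _|]; first by rewrite big1.
exact/trivIset_setIl/trivIset_seqDU.
Qed.

Lemma concentrated_on_support mu : second_countable (T := T) ->
  radon_measure mu ->
  forall B, rcborel B -> mu B = mu (B `&` msupport mu).
Proof.
move=> sT radon_mu B rB; have bS := closed_borel (@closed_msupport mu).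
have rBS : rcborel (B `&` ~` msupport mu).
  by apply: rcborelI => //; exact: (@measurableC _ (borelType T)).
rewrite -[in LHS](setUIDK B (msupport mu)) radonU//.
- rewrite [X in _ + X]measure_off_support ?addr0//.
  by rewrite -setIA setICl setI0.
- exact: rcborelI.
- by rewrite setIACA setICr setI0.
Qed.

End supports.

(** * Topological abelian groups *)

Section topological_groups.
Context (G : topologicalZmodType).
Implicit Types (x y : G) (A K S U V : set G).

Lemma cvg_subG (T : Type) (F : set_system T) (FF : Filter F)
    (f g : T -> G) (a b : G) :
  f @ F --> a -> g @ F --> b -> (fun t => f t - g t) @ F --> a - b.
Proof.
move=> fa gb.
exact: cvg_comp (cvg_pair fa gb) (@sub_continuous G (a, b)).
Qed.

Lemma subr_continuousG x : continuous (fun y : G => y - x).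
Proof. by move=> y; apply: cvg_subG; [exact: cvg_id|exact: cvg_cst]. Qed.

Lemma subl_continuousG x : continuous (fun y : G => x - y).
Proof. by move=> y; apply: cvg_subG; [exact: cvg_cst|exact: cvg_id]. Qed.

Lemma translateE x A : translate x A = [set y | A (y - x)].
Proof.
apply/seteqP; split => [_ [z Az <-]|y Ay].
  by rewrite /= addrAC subrr add0r.
by exists (y - x) => //; rewrite addrC subrK.
Qed.

Lemma nbhs_subr x U : nbhs 0 U -> nbhs x [set y | U (y - x)].
Proof.
by move=> U0; apply: (@subr_continuousG x x); rewrite /= subrr.
Qed.

Lemma nbhs_sub_half U : nbhs 0 U ->
  exists2 V, nbhs 0 V & forall x y, V x -> V y -> U (x - y).
Proof.
move=> U0; have := @sub_continuous G (0, 0) U; rewrite /= subr0 => /(_ U0).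
case=> -[A B] /= [A0 B0] AB; exists (A `&` B); first exact: filterI.
by move=> x y [Ax _] [_ By]; exact: (AB (x, y)).
Qed.

Lemma compact_sub_image (K S : set G) : compact K -> compact S ->
  compact [set x - y | x in K & y in S].
Proof.
move=> cK cS; rewrite (_ : [set _ | _ in _ & _ in _] =
    (fun z : G * G => z.1 - z.2) @` (K `*` S)); last first.
  apply/seteqP; split => [_ [x Kx [y Sy <-]]|_ [[x y] /= [Kx Sy] <-]].
    by exists (x, y).
  by exists x => //; exists y.
apply: continuous_compact; last exact: compact_setX.
by apply: continuous_subspaceT; exact: sub_continuous.
Qed.

Lemma compact_translate x K : compact K -> compact (translate x K).
Proof.
move=> cK; apply: continuous_compact cK; apply: continuous_subspaceT => z.
apply: (@cvg_comp _ _ _ (fun z => (x, z)) (fun z : G * G => z.1 + z.2)).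
  exact: (cvg_pair (cvg_cst x) cvg_id).
exact: (@add_continuous G (x, z)).
Qed.

(** A point of the support is determined by any basic open set that isolates
    it. *)
Lemma discrete_countable (R : realType) (mu : set G -> R[i]) :
  second_countable (T := G) -> discrete_measure mu -> countable (msupport mu).
Proof.
move=> [base cbase [base_open base_nbhs]] disc.
apply: (@sub_countable _ _ _ ((fun b => xget 0 (b `&` msupport mu)) @` base)).
  apply: subset_card_le => x sx; have [U U0 Ux] := disc x sx.
  have [b [bb bx] bU] := base_nbhs x _ (nbhs_subr x U0).
  exists b => //; case: xgetP => [y _ [By sy]|/(_ x)[]//].
  suff : [set x] y by [].
  by rewrite -Ux; split => //; rewrite translateE; exact: bU.
exact: sub_countable (card_image_le _ _) cbase.
Qed.

Section bump.
Variable R : realType.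
Hypotheses (hG : hausdorff_space G) (lcG : locally_compact [set: G]).

(** Urysohn's lemma, available because locally compact Hausdorff spaces are
    completely regular. Being supported in a compact set and vanishing off [V]
    are recorded separately: the closed support need not lie in [V]. *)
Lemma bump_function V : nbhs 0 V ->
  exists (f : G -> R) (S : set G),
    [/\ continuous f, forall x, 0 <= f x, f 0 = 1,
      compact S /\ closed S & forall x, f x != 0 -> V x /\ S x].
Proof.
move=> V0; have [S S0 [cS clS]] := lcG (I : [set: G] 0).
have {}S0 : nbhs 0 S by move: S0; rewrite /within/=; apply: filterS => x; exact.
have VS0 : nbhs 0 (V `&` S) by exact: filterI.
have clB : closed (~` interior (V `&` S)).
  by apply: open_closedC; exact: open_interior.
have nB0 : ~ (~` interior (V `&` S)) 0 by apply; exact: VS0.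
have /(uniform_separatorP (R := R))[u [cu u01 u0 u1]] :=
  locally_compact_completely_regular (R := R) lcG hG clB nB0.
exists (fun x => 1 - u x), S; split.
- by move=> x; apply: cvgB; [exact: cvg_cst|exact: cu].
- move=> x; have : `[0, 1]%classic (u x) by apply: u01; exists x.
  by rewrite /= in_itv/= subr_ge0 => /andP[].
- by rewrite (_ : u 0 = 0) ?subr0//; apply: u0; exists 0.
- by [].
- move=> x ux; have : interior (V `&` S) x.
    apply: contrapT => nx; move/eqP: ux; apply.
    by rewrite (_ : u x = 1) ?subrr//; apply: u1; exists x.
  by move=> /interior_subset[].
Qed.

(** Continuity of [(x, v) |-> f x - f (x - v)] at [(x, 0)] gives a neighborhood
    of [0] that depends on [x]; compactness of [S] makes it uniform in [S], and
    [f] vanishes elsewhere. *)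
Lemma uniform_continuity (f : G -> R) S : continuous f -> compact S ->
  (forall x, f x != 0 -> S x) -> forall e, 0 < e ->
  exists2 V, nbhs 0 V & forall x y, V (x - y) -> `|f x - f y| < e.
Proof.
move=> cf /compact_near_coveringP cS fS e e0.
have : \forall v \near (0 : G), S `<=` [set x | `|f x - f (x - v)| < e].
  apply: cS => x Sx.
  have : (fun z : G * G => f z.1 - f (z.1 - z.2)) @ (x, 0) --> f x - f (x - 0).
    apply: cvgB.
      by apply: (@cvg_comp _ _ _ fst f); [exact: cvg_fst|exact: cf].
    apply: (@cvg_comp _ _ _ (fun z : G * G => z.1 - z.2) f); last exact: cf.
    exact: (@sub_continuous G (x, 0)).
  by rewrite subr0 subrr => /cvgr0Pnorm_lt /(_ _ e0).
pose V := [set v | S `<=` [set x | `|f x - f (x - v)| < e]] => V0.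
have {}V0 : nbhs 0 V by exact: V0.
have NV0 : nbhs 0 [set v | V (0 - v)].
  by apply: (@subl_continuousG 0 0); rewrite /= subr0.
exists (V `&` [set v | V (0 - v)]) => [|x y [Vxy VNxy]]; first exact: filterI.
have [Sx|nSx] := pselect (S x).
  by have /= := Vxy _ Sx; rewrite subKr.
have [Sy|nSy] := pselect (S y).
  have /= := VNxy _ Sy; rewrite sub0r opprB subKr.
  by rewrite distrC.
have f0 z : ~ S z -> f z = 0.
  by move=> nSz; apply/eqP; apply: contra_notT nSz; exact: fS.
by rewrite !f0// subrr normr0.
Qed.

End bump.
End topological_groups.

(** * Haar measure *)

Lemma continuous_borel (R : realType) (T : ptopologicalType) (h : T -> R) :
  continuous h -> measurable_fun [set: borelType T] h.
Proof.
move=> /continuousP ch; apply: (measurability _ (RGenOInfty.measurableE R)).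
move=> _ [_ [r ->] <-]; rewrite setTI.
apply: open_borel; apply: ch; exact: interval_open.
Qed.

Section haar_integration.
Context (R : realType) (G : topologicalZmodType).
Variable m : {measure set (borelType G) -> \bar R}.
Hypotheses (hG : hausdorff_space G) (m_haar : haar_measure m).

Lemma integrable_compact_support (h : G -> R) (S : set G) :
  continuous h -> compact S -> (forall x, h x != 0 -> S x) ->
  m.-integrable [set: borelType G] (EFin \o h).
Proof.
move=> ch cS hS; have mh := continuous_borel ch.
have mS : measurable (S : set (borelType G)).
  by apply: closed_borel; exact: compact_closed.
have -> : EFin \o h = ((EFin \o h) \_ S)%E.
  apply/funext => x /=; rewrite patchE; case: ifPn => // /negP nSx.
  have [->//|/hS Sx] := eqVneq (h x) 0.
  by exfalso; apply: nSx; rewrite inE.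
apply: (integrable_mkcond (EFin \o h : borelType G -> \bar R) mS).1.
apply: measurable_bounded_integrable => //.
- exact: (haar_finite m_haar cS).
- exact: (measurable_funS _ _ mh).
- have := continuous_compact (continuous_subspaceT (A := S) ch) cS.
  move=> /compact_bounded[M [Mr hM]]; exists M; split => // N MN x Sx.
  by apply: (hM N MN); exists x.
Qed.

Lemma haar_integral_translate (h : G -> R) (t : G) :
  measurable_fun [set: borelType G] h ->
  m.-integrable [set: borelType G] (fun x => (h (x - t))%:E) ->
  (\int[m]_x (h (x - t))%:E = \int[m]_x (h x)%:E)%E.
Proof.
move=> mh ih; pose phi : borelType G -> borelType G := fun x => x - t.
have mphi : measurable_fun [set: borelType G] phi.
  apply: (@measurability _ _ (borelType G) (borelType G) setT phi (@open G))
    => // _ [A oA <-]; rewrite setTI.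
  by apply: open_borel; apply: open_comp => // x _; exact: subr_continuousG.
have := @integral_pushforward _ _ (borelType G) (borelType G) R phi mphi m
  setT (EFin \o h).
rewrite preimage_setT => <- //; last exact/measurable_EFinP.
apply: eq_measure_integral => A mA _.
by rewrite /pushforward -(haar_invariant m_haar t mA) translateE.
Qed.

Hypothesis sG : second_countable (T := G).

(** If [U] were null, all its translates would be, and countably many of them
    cover the group. *)
Lemma haar_open_gt0 (U : set G) : nbhs 0 U -> open U -> (0 < m U)%E.
Proof.
move=> U0 oU; rewrite lt_neqAle measure_ge0 andbT; apply/eqP => /esym mU0.
have bU := open_borel oU.
pose null (A : set G) := exists2 t, A `<=` translate t U & True.
have [||V [oV VE VG]] := @countable_open_cover G null setT sG.
- by move=> A B BA [t At _]; exists t => //; exact: subset_trans At.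
- move=> x _; exists (translate x U); last by exists x.
  rewrite translateE; split; last by rewrite /= subrr; exact: nbhs_singleton.
  by apply: open_comp => // y _; exact: subr_continuousG.
have mV k : m (V k) = 0%E.
  case: (VE k) => [->|[t Vt _]]; first by rewrite measure0.
  apply/eqP; rewrite eq_le measure_ge0 andbT -mU0.
  rewrite -(haar_invariant m_haar t bU) le_measure ?inE//.
  - exact: open_borel.
  - rewrite translateE; apply: open_borel.
    by apply: open_comp => // y _; exact: subr_continuousG.
have /eqP := haar_neq0 m_haar; apply.
apply/eqP; rewrite eq_le measure_ge0 andbT.
apply: le_trans
  (measure_sigma_subadditive m (A := setT) (F := V) _ _ _) _ => //.
- by move=> k; exact: open_borel.
- by rewrite eseries0// => k _ _; exact: mV.
Qed.

End haar_integration.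

(** * Autocorrelations as test functions *)

Section test_functions.
Context (R : realType) (G : topologicalZmodType).
Variable m : {measure set (borelType G) -> \bar R}.
Hypotheses (hG : hausdorff_space G) (lcG : locally_compact [set: G]).
Hypotheses (sG : second_countable (T := G)) (m_haar : haar_measure m).

Lemma Cintegral_real (h : G -> R) :
  Cintegral m (fun x => (h x)%:C) = (\int[m]_x h x)%:C.
Proof. by rewrite /Cintegral/= integral0. Qed.

Lemma ccontinuous_real (T : topologicalType) (h : T -> R) :
  continuous h -> ccontinuous (fun x => (h x)%:C).
Proof.
by move=> ch; apply/ccontinuous_ReImP; split => // x; exact: cvg_cst.
Qed.

Lemma Cc_real (h : G -> R) (S : set G) : continuous h -> compact S ->
  (forall x, h x != 0 -> S x) -> Cc (fun x => (h x)%:C).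
Proof.
move=> ch cS hS; split; first exact: ccontinuous_real.
apply: (subclosed_compact _ cS); first exact: closed_closure.
rewrite [X in _ `<=` X](closure_id S).1; last exact: compact_closed.
by apply: closureS => x /= hx; apply: hS; apply: contra_neq hx => ->.
Qed.

Section autocorrelation.
Variables (f : G -> R) (S : set G).
Hypotheses (cf : continuous f) (f_ge0 : forall x, 0 <= f x) (cS : compact S).
Hypothesis (fS : forall x, f x != 0 -> S x).

(** This is the convolution of [f] with its reflection [f (- x)]. *)
Definition autocorrelation (x : G) : R := \int[m]_y (f y * f (y - x)).

Let cfsub x : continuous (fun y => f (y - x)).
Proof.
move=> y; apply: (@cvg_comp _ _ _ (fun y => y - x) f); last exact: cf.
exact: subr_continuousG.
Qed.

Let int_f : m.-integrable [set: borelType G] (EFin \o f).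
Proof. exact: integrable_compact_support cf cS fS. Qed.

Let int_ff x :
  m.-integrable [set: borelType G] (EFin \o (fun y => f y * f (y - x))).
Proof.
apply: (integrable_compact_support hG m_haar _ cS) => y.
  by apply: cvgM; [exact: cf|exact: cfsub].
by rewrite mulf_eq0 negb_or => /andP[/fS].
Qed.

Lemma autocorrelation_supp x : autocorrelation x != 0 ->
  exists2 y, f y != 0 & f (y - x) != 0.
Proof.
apply: contra_neqP => /forall2NP nf.
rewrite /autocorrelation /Rintegral integral0_eq// => y _; congr EFin.
apply/eqP; rewrite mulf_eq0; apply/orP.
by case: (nf y) => /negP; rewrite negbK; [left|right].
Qed.

Lemma autocorrelation_continuous : continuous autocorrelation.
Proof.
move=> x; apply/cvgrPdist_le => e e0.
set I := \int[m]_y f y.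
have I_ge0 : 0 <= I by apply: Rintegral_ge0 => y _; exact: f_ge0.
have d0 : 0 < e / (I + 1) by rewrite divr_gt0// ltr_wpDl.
have [V V0 fV] := uniform_continuity cf cS fS d0.
move: (nbhs_subr x V0).
apply: filterS => z Vxz.
rewrite /autocorrelation -RintegralB//.
have int_B : m.-integrable [set: borelType G]
    (EFin \o (fun y => f y * f (y - x) - f y * f (y - z))).
  exact: (integrableB _ (int_ff x) (int_ff z)).
apply: le_trans (le_normr_Rintegral _ int_B) _ => //.
apply: (@le_trans _ _ (\int[m]_y (e / (I + 1) * f y))).
  apply: le_Rintegral => //.
  - exact: (integrable_norm int_B).
  - exact: (integrableZl measurableT (e / (I + 1)) int_f).
  - move=> y _; rewrite -mulrBr normrM ger0_norm// mulrC ler_wpM2r//.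
    by apply/ltW/fV; rewrite opprB addrC subrKA.
rewrite RintegralZl// -mulrA ler_piMr//; first exact: ltW.
by rewrite mulrC ler_pdivrMr ?mul1r ?lerDl// ltr_wpDl.
Qed.

Lemma autocorrelation0_gt0 : f 0 = 1 -> 0 < autocorrelation 0.
Proof.
move=> f0; pose O : set (borelType G) := [set x | 1 / 2 < f x].
have oO : open (O : set G).
  have := @open_comp _ _ f [set r | 1 / 2 < r] (fun x _ => cf (x := x)).
  by apply; exact: open_gt.
have mO : (0 < m O)%E.
  apply: haar_open_gt0 => //; apply: open_nbhs_nbhs; split=> //.
  by rewrite /O/= f0; lra.
have mmO : measurable O by exact: open_borel.
have ff_ge0 x : (0 <= (f x * f (x - 0))%:E)%E by rewrite lee_fin mulr_ge0.
have mff := measurable_int m (int_ff 0).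
apply: fine_gt0; apply/andP; split; last first.
  rewrite -ge0_fin_numE; last by apply: integral_ge0 => x _; exact: ff_ge0.
  exact: (integrable_fin_num measurableT (int_ff 0)).
apply: (@lt_le_trans _ _ (\int[m]_(x in O) (4^-1)%:E)%E).
  by rewrite integral_cst// mule_gt0// lte_fin invr_gt0.
apply: (@le_trans _ _ (\int[m]_(x in O) (f x * f (x - 0))%:E)%E).
  apply: ge0_le_integral => //.
  - exact: (measurable_funS _ _ mff).
  - by move=> x; rewrite /O/= lee_fin subr0 => Ox; nra.
by apply: ge0_subset_integral.
Qed.

(** The translation is absorbed by the second factor of the convolution. *)
Lemma autocorrelation_K2 t : K2 m (fun x => (autocorrelation (x - t))%:C).
Proof.
exists 1%N, (fun=> 1), (fun _ x => (f x)%:C), (fun _ x => (f (t - x))%:C).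
split=> [_|].
  split; first exact: Cc_real cf cS fS.
  apply: (@Cc_real _ [set t - s | s in S]).
  - move=> x; apply: (@cvg_comp _ _ _ (fun x => t - x) f); last exact: cf.
    exact: subl_continuousG.
  - apply: continuous_compact cS.
    by apply: continuous_subspaceT; exact: subl_continuousG.
  - by move=> x /fS Sx; exists (t - x) => //; rewrite subKr.
apply/funext => x; rewrite big_ord1 mul1r /convolution.
under [X in Cintegral _ X]eq_fun do rewrite -rmorphM/=.
rewrite Cintegral_real; congr (_%:C); apply: eq_Rintegral => y _.
by congr (_ * f _); rewrite !opprB addrCA.
Qed.

End autocorrelation.

(** The autocorrelation of a bump function living on a small [V] lives on the
    difference set of [V], hence on [W], and is positive at the origin. *)
Lemma test_function (W : set G) : nbhs 0 W ->
  exists (g : G -> R) (C : set G), [/\ continuous g, 0 < g 0, compact C,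
    forall x, g x != 0 -> W x /\ C x &
    forall t, K2 m (fun x => (g (x - t))%:C)].
Proof.
move=> /nbhs_sub_half[V V0 VW].
have [f [S [cf f_ge0 f01 [cS _] fVS]]] := bump_function R hG lcG V0.
have fS x : f x != 0 -> S x by move=> /fVS[].
exists (autocorrelation f), [set x - y | x in S & y in S]; split.
- exact: (autocorrelation_continuous cf f_ge0 cS fS).
- exact: (autocorrelation0_gt0 cf f_ge0 cS fS f01).
- exact: (compact_sub_image cS cS).
- move=> x /autocorrelation_supp[y /fVS[Vy Sy] /fVS[Vyx Syx]].
  by rewrite -(subKr y x); split; [exact: VW|exists y => //; exists (y - x)].
- exact: (autocorrelation_K2 cf cS fS).
Qed.

End test_functions.

(** * The dual group *)

Section dual_group.
Context (R : realType) (G : topologicalZmodType).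
Local Notation dual := (character R G).
Local Notation Re := complex.Re.
Local Notation Im := complex.Im.

Lemma character_eq (chi psi : dual) : (forall t, chi t = psi t) -> chi = psi.
Proof.
case: chi psi => [f cf uf af] [g cg ug ag] /= /funext fg.
by subst g; congr Character; exact: Prop_irrelevance.
Qed.

(** Evaluation at a point is continuous for the compact-open topology, and
    evaluations separate characters. Closedness of points is what makes finite
    sets of characters Borel. *)
Lemma dual_accessible : accessible_space dual.
Proof.
move=> chi psi chipsi.
have [t chit] : exists t, chi t != psi t.
  apply: contrapT => nt; move/eqP: chipsi; apply; apply: character_eq => t.
  by apply/eqP; apply: contrapT => /negP chit; apply: nt; exists t.
pose O : set {compact-open, G -> R[i]^o} :=
  [set f | f @` [set t] `<=` [set z | z != psi t]].

exists ((@char_fun R G : dual -> {compact-open, G -> R[i]^o}) @^-1` O); split.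
- exists O => //; apply: compact_open_open; first exact: compact_set1.
  rewrite (_ : [set z | z != psi t] = ~` [set psi t]); last first.
    by apply/seteqP; split => z /eqP.
  apply: closed_openC; apply: accessible_closed_set1.
  by apply: hausdorff_accessible; exact: norm_hausdorff.
- by rewrite inE => _ [_ -> <-].
- rewrite inE => Opsi.
  have : [set z | z != psi t] (psi t) by apply: Opsi; exists t.
  by rewrite /= eqxx.
Qed.

End dual_group.

(** * Almost periods *)

Section almost_periods.
Context (R : realType) (G : topologicalZmodType).
Hypothesis ncG : ~ compact [set: G].
Local Notation dual := (character R G).
Local Notation Re := complex.Re.
Local Notation Im := complex.Im.

(** Finitely many translates of a compact set do not exhaust a noncompact
    group, so a new point can always be added far from the previous ones. *)
Lemma spread_out_seq (K : set G) : compact K -> forall N,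
  exists s : seq G, size s = N /\
    forall i j, (i < j < N)%N -> ~ K (nth 0 s j - nth 0 s i).
Proof.
move=> cK; elim=> [|N [s [sN sK]]].
  by exists [::]; split => // i j; rewrite ltn0 andbF.
have [x xK] : exists x, forall y, y \in s -> ~ K (x - y).
  apply: contrapT => nx; apply: ncG.
  have -> : [set: G] = \bigcup_(y in [set` s]) translate y K.
    apply/seteqP; split => // x _; apply: contrapT => nxK; apply: nx; exists x.
    move=> y sy Kxy; apply: nxK; exists y => //.
    by rewrite translateE.
  rewrite bigcup_seq; apply: bigsetU_compact => y _.
  exact: compact_translate.
exists (rcons s x); split; first by rewrite size_rcons sN.
move=> i j /andP[ij]; rewrite ltnS leq_eqVlt => /predU1P[jN|jN].
  have iN : (i < N)%N by rewrite -jN.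
  by rewrite !nth_rcons sN jN ltnn eqxx iN; apply/xK/mem_nth; rewrite sN.
by rewrite !nth_rcons sN jN (ltn_trans ij jN); apply: sK; rewrite ij.
Qed.

Lemma pigeonhole (B : finType) (f : 'I_(#|B|.+1) -> B) :
  exists i j : 'I_(#|B|.+1), (i < j)%N /\ f i = f j.
Proof.
have /injectivePn[i [j ij fij]] : ~~ injectiveb f.
  apply/negP => /injectiveP/leq_card; by rewrite card_ord ltnn.
have [lij|] := ltnP i j; first by exists i, j.
rewrite leq_eqVlt => /predU1P[/val_inj eij|lji].
  by rewrite eij eqxx in ij.
by exists j, i.
Qed.

Lemma truncn_eq_dist (x y : R) : 0 <= x -> 0 <= y ->
  Num.truncn x = Num.truncn y -> `|x - y| < 1.
Proof.
move=> x0 y0 xy.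
have /andP[lx ux] := truncn_itv x0; have /andP[ly uy] := truncn_itv y0.
move: lx ux ly uy; rewrite xy -natr1 => *; rewrite ltr_norml; lra.
Qed.

Lemma character_dist (chi : dual) x y :
  cabs (chi (x - y) - 1) = cabs (chi x - chi y).
Proof.
rewrite -[RHS](_ : cabs ((chi (x - y) - 1) * chi y) = _).
  by rewrite cabsM char_unitary mulr1.
by rewrite mulrBl mul1r -char_add subrK.
Qed.

(** Dirichlet's argument. Among sufficiently many points spread out in the
    group, two have all their character values in the same cells of a fine grid;
    their difference is an almost period, and it lies outside [K] because the
    points are spread out. *)
Lemma almost_period (I : finType) (chi : I -> dual) (K : set G) (d : R) :
  compact K -> 0 < d ->
  exists2 x, ~ K x & forall i, cabs (chi i x - 1) < d.
Proof.
move=> cK d0; pose M := (Num.truncn (2 / d)).+1.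
have dM : 2 / d < M%:R by rewrite truncnS_gt.
have M0 : 0 < M%:R :> R by rewrite ltr0n.
(* position of a point of [-1, 1] in a grid of mesh 1/M *)
pose cell (r : R) : 'I_(M.*2.+1) := inord (Num.truncn ((r + 1) * M%:R)).
have cellP (r r' : R) : `|r| <= 1 -> `|r'| <= 1 -> cell r = cell r' ->
    `|r - r'| < d / 2.
  move=> r1 r'1.
  have range (q : R) : `|q| <= 1 -> 0 <= (q + 1) * M%:R /\
      (Num.truncn ((q + 1) * M%:R) < M.*2.+1)%N.
    move=> q1; have : -1 <= q <= 1 by rewrite -ler_norml.
    move=> /andP[qa qb]; have q0 : 0 <= (q + 1) * M%:R by apply: mulr_ge0; lra.
    split => //; rewrite ltnS -(ler_nat R).
    apply: (@le_trans _ _ ((q + 1) * M%:R)).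
      by have /andP[] := truncn_itv q0.
    by rewrite -muln2 natrM mulrC ler_pM2l//; lra.
  have [r0 rM] := range _ r1; have [r'0 r'M] := range _ r'1.
  move=> /(congr1 val)/=; rewrite !inordK// => /(truncn_eq_dist r0 r'0).
  rewrite -mulrBl normrM [X in _ * X]gtr0_norm// -ltr_pdivlMr//.
  rewrite opprD addrACA subrr addr0 => /lt_le_trans; apply.
  rewrite div1r invf_ple ?posrE ?divr_gt0//.
  by rewrite invf_div ltW.
pose f (s : seq G) (j : nat) : {ffun I -> 'I_(M.*2.+1) * 'I_(M.*2.+1)} :=
  [ffun i => (cell (Re (chi i (nth 0 s j))), cell (Im (chi i (nth 0 s j))))].
set N := #|{ffun I -> 'I_(M.*2.+1) * 'I_(M.*2.+1)}|.
have [s [sN sK]] := spread_out_seq cK N.+1.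
have [j [k [jk fjk]]] := pigeonhole (fun j : 'I_N.+1 => f s j).
exists (nth 0 s k - nth 0 s j); first by apply: sK; rewrite jk ltn_ord.
move=> i; rewrite character_dist.
have unit_Re z : cabs z = 1 -> `|Re z| <= 1 by move=> <-; exact: ler_Re_cabs.
have unit_Im z : cabs z = 1 -> `|Im z| <= 1 by move=> <-; exact: ler_Im_cabs.
have /ffunP/(_ i) := fjk; rewrite !ffunE => -[re im].
rewrite (le_lt_trans (cabs_le_ReIm _))// [ltRHS]splitr.
rewrite ReB ImB ltrD//; apply: cellP;
  by rewrite ?unit_Re ?unit_Im ?char_unitary.
Qed.

End almost_periods.

(** * Absolutely convergent trigonometric series *)

Section almost_periodic_functions.
Context (R : realType) (G : topologicalZmodType).
Local Notation dual := (character R G).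
Implicit Types (chi : nat -> dual) (b : nat -> R[i]) (h : G -> R[i]).

Definition trigonometric_series chi b h :=
  (\sum_(0 <= k <oo) (cabs (b k))%:E < +oo)%E /\
  forall t, (fun n => \sum_(0 <= k < n) b k * chi k t : R[i]^o) @ \oo -->
    (h t : R[i]^o).

(** Finitely many characters control the sum up to a uniformly small tail, so an
    approximate common period of these characters is an almost period of the
    whole sum. *)
Lemma trigonometric_series_translate chi b h (e : R) :
  trigonometric_series chi b h -> 0 < e ->
  exists n (d : R), 0 < d /\ forall s,
    (forall k, (k < n)%N -> cabs (chi k s - 1) < d) ->
    forall t, cabs (h (t + s) - h t) <= e.
Proof.
move=> [b_sum hE] e0.
have := cvg_fine_nneseries (fun k => cabs_ge0 (b k)) b_sum.
set B := fine _ => cB.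
have leB n : \sum_(0 <= k < n) cabs (b k) <= B.
  have bn : nondecreasing_seq (series (fun k => cabs (b k))).
    by apply: nondecreasing_series => k *; exact: cabs_ge0.
  rewrite -(cvg_lim _ cB)//; apply: (nondecreasing_cvgn_le bn).
  by apply/cvg_ex; exists B.
have B0 : 0 <= B by have := leB 0%N; rewrite big_geq.
have e40 : 0 < e / 4 by rewrite divr_gt0.
have /cvgrPdist_lt/(_ _ e40)[n _ /(_ n (leqnn n)) tail] := cB.
(* the first [n] terms contribute at most [B * d], the others [2 * (e / 4)] *)
pose d := e / (2 * (B + 1)).
have d0 : 0 < d by rewrite divr_gt0// mulr_gt0// ltr_wpDl.
exists n, d; split => // s close t.
apply: (cvg_cabs_le (cvgB (hE (t + s)) (hE t))); near=> N.
have nN : (n <= N)%N by near: N; exists n.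
rewrite fctE -sumrB (le_trans (cabs_sum_le _ _ _))//.
have term k : cabs (b k * chi k (t + s) - b k * chi k t) =
    cabs (b k) * cabs (chi k s - 1).
  rewrite char_add -mulrBr -[X in _ * (_ - X)]mulr1 -mulrBr !cabsM.
  by rewrite char_unitary mul1r.
under eq_bigr do rewrite term.
rewrite (big_cat_nat (n := n))//= [leRHS]splitr lerD//.
  apply: (@le_trans _ _ (\sum_(0 <= k < n) cabs (b k) * d)).
    rewrite big_nat_cond [leRHS]big_nat_cond ler_sum// => k.
    move=> /andP[/andP[_ kn] _].
    by rewrite ler_wpM2l ?cabs_ge0// ltW// close.
  rewrite -mulr_suml (le_trans (y := (B + 1) * d))//.
    by rewrite ler_wpM2r// ?(ltW d0)// (le_trans (leB n))// lerDl.
  rewrite /d le_eqVlt; apply/orP; left; apply/eqP; field.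
  by rewrite gt_eqF// ltr_wpDl.
apply: (@le_trans _ _ (\sum_(n <= k < N) cabs (b k) * 2)).
  rewrite ler_sum// => k _; rewrite ler_wpM2l ?cabs_ge0//.
  rewrite (le_trans (ler_cabsD _ _))// cabsN char_unitary.
  by rewrite /cabs normr1/=; lra.
rewrite -mulr_suml.
have : \sum_(n <= k < N) cabs (b k) <= e / 4.
  have := leB N; rewrite (big_cat_nat (n := n))//= => leN.
  move: tail; rewrite /series/= => /ltr_normlW; lra.
lra.
Unshelve. all: by end_near. Qed.

(** A common almost period outside a large compact set moves [t] to a place
    where the two functions almost agree, and changes neither of them much. *)
Lemma almost_periodic_vanishing chi b h chi' b' h' : ~ compact [set: G] ->
  trigonometric_series chi b h -> trigonometric_series chi' b' h' ->
  (forall e : R, 0 < e -> exists2 K : set G, compact K &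
    forall t, ~ K t -> cabs (h t - h' t) <= e) ->
  forall t, h t = h' t.
Proof.
move=> ncG hser h'ser vanish t; apply/eqP; rewrite -subr_eq0 -cabs_eq0 eq_le.
rewrite cabs_ge0 andbT; apply/ler_addgt0Pr => e e0; rewrite add0r.
have e30 : 0 < e / 3 by rewrite divr_gt0.
have [K cK hK] := vanish _ e30.
have [n [d [d0 hd]]] := trigonometric_series_translate hser e30.
have [n' [d' [d'0 h'd]]] := trigonometric_series_translate h'ser e30.
pose phi (i : 'I_n + 'I_n') :=
  match i with inl k => chi k | inr k => chi' k end.
have dd' : 0 < Num.min d d' by rewrite lt_min d0.
have [s nKs phis] :=
  almost_period ncG phi (@compact_translate G (- t) K cK) dd'.
have nKts : ~ K (t + s).
  by move=> Kts; apply: nKs; exists (t + s) => //; rewrite addKr.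
have hs : cabs (h (t + s) - h t) <= e / 3.
  apply: hd => k kn; have := phis (inl (Ordinal kn)).
  by rewrite lt_min => /andP[].
have h's : cabs (h' (t + s) - h' t) <= e / 3.
  apply: h'd => k kn; have := phis (inr (Ordinal kn)).
  by rewrite lt_min => /andP[].
have -> : h t - h' t = (h (t + s) - h' (t + s)) + (- (h (t + s) - h t)) +
    (h' (t + s) - h' t) by ring.
have := hK _ nKts; move: hs h's => hs h's hts.
rewrite (le_trans (ler_cabsD _ _))//.
rewrite (le_trans (lerD (ler_cabsD _ _) (lexx _)))//.
by rewrite cabsN; lra.
Qed.

End almost_periodic_functions.

(** * Fourier transforms of translated test functions *)

Section fourier_of_translates.
Context (R : realType) (G : topologicalZmodType).
Variable m : {measure set (borelType G) -> \bar R}.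
Hypotheses (hG : hausdorff_space G) (m_haar : haar_measure m).
Local Notation dual := (character R G).
Local Notation Re := complex.Re.
Local Notation Im := complex.Im.
Variables (g : G -> R) (C : set G).
Hypotheses (cg : continuous g) (cC : compact C).
Hypothesis (gC : forall x, g x != 0 -> C x).

Let gt (t : G) := fun x : G => (g (x - t))%:C.

Let cRe (chi : dual) : continuous (fun x => Re (chi x)).
Proof. by have /ccontinuous_ReImP[] := @char_continuous R G chi. Qed.

Let cIm (chi : dual) : continuous (fun x => Im (chi x)).
Proof. by have /ccontinuous_ReImP[] := @char_continuous R G chi. Qed.

Let cgt t : continuous (fun x => g (x - t)).
Proof.
move=> x; apply: (@cvg_comp _ _ _ (fun x => x - t) g); last exact: cg.
exact: subr_continuousG.
Qed.

Let int_gt (h : G -> R) t : continuous h ->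
  m.-integrable [set: borelType G] (EFin \o (fun x => g (x - t) * h x)).
Proof.
move=> ch; apply: (integrable_compact_support hG m_haar _
    (S := [set c - s | c in C & s in [set - t]])).
- by move=> x; apply: cvgM; [exact: cgt|exact: ch].
- by apply: compact_sub_image => //; exact: compact_set1.
- move=> x; rewrite mulf_eq0 negb_or => /andP[/gC Cxt _].
  by exists (x - t) => //; exists (- t) => //; rewrite opprK subrK.
Qed.

Lemma inverse_fourierE t (chi : dual) : inverse_fourier m (gt t) chi =
  (\int[m]_x (g (x - t) * Re (chi x))) +i* (\int[m]_x (g (x - t) * Im (chi x))).
Proof.
rewrite /inverse_fourier /Cintegral; congr (fine _ +i* fine _);
  apply: eq_integral => x _; congr EFin; rewrite ?ReM ?ImM /gt/=.
- by rewrite mul0r subr0.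
- by rewrite mul0r addr0.
Qed.

(** For a real test function the two transforms are conjugate. Hence the
    integrability required of [fourier] passes to [inverse_fourier], which is
    the one that occurs in the pairing. *)
Lemma fourierE t (chi : dual) :
  fourier m (gt t) chi = (inverse_fourier m (gt t) chi)^*.
Proof.
rewrite inverse_fourierE /fourier /Cintegral /=.
have -> : - (\int[m]_x (g (x - t) * Im (chi x))) =
    \int[m]_x (- 1 * (g (x - t) * Im (chi x))).
  by rewrite RintegralZl ?mulN1r//; exact: int_gt.
congr (fine _ +i* fine _); apply: eq_integral => x _; congr EFin;
  rewrite ?ReM ?ImM /gt; case: (chi x) => a b /=.
- by rewrite mul0r subr0.
- by rewrite mul0r addr0 mulrN mulN1r.
Qed.

Lemma character_sub (chi : dual) x t : chi x = chi t * chi (x - t).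
Proof. by rewrite -char_add addrC subrK. Qed.

(** Invariance of Haar measure turns translation by [t] into multiplication by
    [chi t]. *)
Lemma inverse_fourier_translate t (chi : dual) :
  inverse_fourier m (gt t) chi = chi t * inverse_fourier m (gt 0) chi.
Proof.
have shift (h : G -> R) : continuous h ->
    \int[m]_x (g (x - t) * h (x - t)) = \int[m]_x (g (x - 0) * h x).
  move=> ch; rewrite (_ : (fun x => g (x - 0) * h x) = (fun x => g x * h x)).
    congr fine.
    apply: (haar_integral_translate m_haar (h := fun x => g x * h x)).
      by apply: continuous_borel => x; apply: cvgM; [exact: cg|exact: ch].
    apply: (int_gt (h := fun x => h (x - t))) => x.
    apply: (@cvg_comp _ _ _ (fun x => x - t) h); last exact: ch.
    exact: subr_continuousG.
  by apply/funext => x; rewrite subr0.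
rewrite !inverse_fourierE.
have combine (a b : R) :
    \int[m]_x (g (x - t) * (a * Re (chi (x - t)) + b * Im (chi (x - t)))) =
    a * \int[m]_x (g (x - 0) * Re (chi x)) +
    b * \int[m]_x (g (x - 0) * Im (chi x)).
  rewrite (shift (fun x => a * Re (chi x) + b * Im (chi x))); last first.
    move=> x; apply: cvgD; apply: cvgM;
      by [exact: cvg_cst|exact: cRe|exact: cIm].
  rewrite -!RintegralZl//; [|exact: int_gt|exact: int_gt].
  rewrite -RintegralD//.
  - apply: eq_Rintegral => x _; rewrite mulrDr.
    by congr (_ + _); rewrite mulrCA.
  - exact: (integrableZl measurableT _ (int_gt _ _)).
  - exact: (integrableZl measurableT _ (int_gt _ _)).
apply/eqP; rewrite eq_complex /= !ReM !ImM/=; apply/andP; split; apply/eqP.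
  rewrite -mulNr -combine; apply: eq_Rintegral => x _.
  by rewrite (character_sub chi x t) ReM mulNr.
rewrite addrC -combine; apply: eq_Rintegral => x _.
by rewrite (character_sub chi x t) ImM [X in _ = _ * X]addrC.
Qed.

(** The pairing with the translate by [t] is the pairing of the transform with
    [chi t] times a fixed summable function of [chi]: summing over the atoms
    [chi] of the transform gives an absolutely convergent series of characters
    evaluated at [t]. *)
Lemma transform_almost_periodic (mu : set G -> R[i])
    (muhat : set dual -> R[i]) :
  (forall t, K2 m (gt t)) -> fourier_transform m mu muhat -> pure_point muhat ->
  exists (chi : nat -> dual) (b : nat -> R[i]),
    trigonometric_series chi b (fun t => pairing mu (gt t)).
Proof.
move=> gK2 [radon_hat ft_pair ft_int] pp.
have T1 := @dual_accessible R G.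
have [X cX muX] := pure_point_concentrated T1 pp.
have [e [_ /(_ _ radon_hat muX)[a [hat_atomic _ _]]]] :=
  concentrated_atomic R T1 cX.
have fourier_summable t :
    (\sum_(0 <= k <oo) (cabs (a k) * cabs (fourier m (gt t) (e k)))%:E < +oo)%E.
  have [mRe mIm] := ft_int _ (gK2 t).
  have mF : measurable_fun [set: borelType dual]
      (fun chi => (cabs (fourier m (gt t) chi))%:E).
    apply/measurable_EFinP; under eq_fun do rewrite cabsE.
    apply: (measurableT_comp (continuous_measurable_fun (@sqrt_continuous R))).
    by apply: measurable_funD; exact: measurable_funX.
  rewrite (@eq_set_function_integral _ (borelType dual) R _ _ _
    (mvariation_atomic T1 hat_atomic)).
  rewrite ge0_integral_weighted_diracs// => chi.
  by rewrite lee_fin cabs_ge0.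
have inv_summable t : (\sum_(0 <= k <oo)
    (cabs (a k) * cabs (inverse_fourier m (gt t) (e k)))%:E < +oo)%E.
  apply: le_lt_trans (fourier_summable t); apply: lee_nneseries => k *.
    by rewrite lee_fin mulr_ge0 ?cabs_ge0.
  by rewrite fourierE cabsJ.
exists e, (fun k => a k * inverse_fourier m (gt 0) (e k)); split.
  apply: le_lt_trans (inv_summable 0); apply: lee_nneseries => k *.
    by rewrite lee_fin cabs_ge0.
  by rewrite cabsM.
move=> t; rewrite ft_pair//.
rewrite (_ : (fun n => _) = (fun n => \sum_(0 <= k < n)
    a k * inverse_fourier m (gt t) (e k) : R[i]^o)); last first.
  apply/funext => n; apply: eq_bigr => k _.
  by rewrite (inverse_fourier_translate t) -mulrA [_ * e k t]mulrC.
have [mRe mIm _] := ft_int _ (gK2 t).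
have ReJ z : Re (z^*) = Re z :> R by case: z.
have ImJ z : Im (z^*) = - Im z :> R by case: z.
apply: (pairing_atomic T1 hat_atomic).
- by apply: eq_measurable_fun mRe => chi _; rewrite fourierE ReJ.
- apply: eq_measurable_fun (measurable_funN mIm) => chi _.
  transitivity (- Im (fourier m (gt t) chi)); first by [].
  by rewrite fourierE ImJ opprK.
- exact: inv_summable.
Qed.

End fourier_of_translates.

(** * Pairings with finitely many atoms *)

Section finite_sums.
Context (R : realType).

Lemma cabs_fsum_le (T : choiceType) (A B : set T) (F : T -> R[i]) (c : R) n n' :
  (A #<= `I_n)%card -> (B #<= `I_n')%card -> 0 <= c ->
  (forall x, (A `|` B) x -> cabs (F x) <= c) ->
  cabs (\sum_(x \in A `|` B) F x) <= (n + n')%:R * c.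
Proof.
move=> An Bn c0 Fc.
have fA : finite_set A by apply/finite_set_leP; exists n.
have fB : finite_set B by apply/finite_set_leP; exists n'.
have fAB : finite_set (A `|` B) by rewrite finite_setU.
rewrite fsbig_finite//= (le_trans (cabs_sum_le _ _ _))//.
rewrite (le_trans (y := \sum_(x <- finmap.enum_fset (fset_set (A `|` B))) c))//.
  rewrite big_seq [leRHS]big_seq ler_sum// => x.
  by rewrite in_fset_set// inE => /Fc.
rewrite big_const_seq count_predT iter_addr_0 mulr_natl ler_wpMn2l//.
rewrite fset_setU// finmap.cardfsU (leq_trans (leq_subr _ _))// leq_add//.
  exact: geq_card_fset_set.
exact: geq_card_fset_set.
Qed.

(** A function that meets finitely many atoms is trivially summable, and the
    series of [pairing_atomic] is a finite sum. *)
Lemma pairing_finite (T : ptopologicalType) (T1 : accessible_space T)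
    (mu : set T -> R[i]) (X : set T) (f : T -> R[i]) :
  radon_measure mu -> countable X ->
  (forall B, rcborel B -> mu B = mu (B `&` X)) ->
  measurable_fun [set: borelType T] (fun x => complex.Re (f x)) ->
  measurable_fun [set: borelType T] (fun x => complex.Im (f x)) ->
  finite_set (X `&` [set x | f x != 0]) ->
  pairing mu f = \sum_(x \in X) mu [set x] * f x.
Proof.
move=> radon_mu cX muX mRe mIm; set Y := X `&` _ => fY.
have [e [r /(_ _ radon_mu muX)[a [mu_atomic aX Xr]]]] :=
  concentrated_atomic R T1 cX.
have [N rN] : exists N, forall x, Y x -> (r x < N)%N.
  have /finite_seqP[s sE] : finite_set (r @` Y) by exact: finite_image.
  exists (\max_(i <- s) i).+1 => x Yx; rewrite ltnS.
  have : r x \in s.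
    have : (r @` Y) (r x) by exists x.
    by rewrite sE.
  by move=> rs; rewrite (big_rem _ rs)/= leq_max leqnn.
have supp k : a k * f (e k) != 0 -> Y (e k) /\ r (e k) = k.
  by rewrite mulf_eq0 negb_or => /andP[/aX[Xek rek] fek]; split.
have term0 k : (N <= k)%N -> a k * f (e k) = 0.
  move=> Nk; apply/eqP; apply: contraTT Nk => /supp[/rN + rek].
  by rewrite rek -ltnNge.
have psum n : (N <= n)%N ->
    \sum_(0 <= k < n) a k * f (e k) = \sum_(0 <= k < N) a k * f (e k).
  move=> Nn; rewrite (big_cat_nat (n := N))//= [X in _ + X]big_nat_cond.
  rewrite [X in _ + X]big1 ?addr0// => k /andP[/andP[Nk _] _]; exact: term0.
have summable : (\sum_(0 <= k <oo) (cabs (a k) * cabs (f (e k)))%:E < +oo)%E.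
  rewrite (_ : limn _ = (\sum_(0 <= k < N) (cabs (a k) * cabs (f (e k)))%:E)%E).
    by rewrite sumEFin ltry.
  apply: lim_near_cst => //; exists N => // n /= Nn.
  rewrite (big_cat_nat (n := N))//= [X in (_ + X)%E]big_nat_cond.
  rewrite [X in (_ + X)%E]big1 ?adde0// => k /andP[/andP[Nk _] _].
  by rewrite -cabsM term0// cabs0.
have := pairing_atomic T1 mu_atomic mRe mIm summable.
move=> /(@cvg_cst_eq _ R[i]^o _ _ _ N psum) ->.
transitivity (\sum_(k \in `I_N) a k * f (e k)).
  by rewrite -fsbig_ord [LHS]big_mkord.
rewrite -(fsbig_widen (r @` Y)); last 2 first.
- by move=> _ [x Yx <-]; exact: rN.
- move=> k [_ /= nk]; apply/eqP; apply: contra_notT nk => /supp[Yek rek].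
  by exists (e k).
rewrite fsbig_image; last first.
  move=> x y; rewrite !inE => -[Xx _] [Xy _] rxy.
  by have [<- _] := Xr x Xx; rewrite rxy; have [-> _] := Xr y Xy.
rewrite -[RHS](fsbig_widen Y); last 2 first.
- by move=> x [].
- move=> x [Xx /not_andP[//|/negP]]; rewrite negbK => /eqP /= ->.
  by rewrite mulr0.
by apply: eq_fsbigr => x /set_mem[Xx _]; have [-> ->] := Xr x Xx.
Qed.

End finite_sums.

(** * Measures that come close at infinity *)

Section close_measures.
Context (R : realType) (G : topologicalZmodType).
Hypotheses (hG : hausdorff_space G) (sG : second_countable (T := G)).

Let T1 : accessible_space G.
Proof. exact: hausdorff_accessible. Qed.

(** Translation boundedness for the compact set reduced to the origin. *)
Lemma atoms_bounded (nu : set G -> R[i]) : radon_measure nu ->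
  translation_bounded nu -> exists2 M : R, 0 <= M &
    forall y, cabs (nu [set y]) <= M.
Proof.
move=> radon_nu tb; have := tb [set 0] (@compact_set1 G 0).
set s := ereal_sup _ => soo.
have nu_s y : ((cabs (nu [set y]))%:E <= s)%E.
  apply: (@le_trans _ _ (mvariation nu (translate y [set 0]))).
    apply: cabs_le_mvariation => //; first exact: rcborel_finite.
    by move=> _ ->; exists 0; rewrite ?addr0.
  by apply: ereal_sup_ubound; exists y.
case: s soo nu_s => [M _ nuM|//|_ nuM]; last by have := nuM 0.
exists M => [|y]; last by rewrite -lee_fin.
by rewrite (le_trans (cabs_ge0 (nu [set 0])))// -lee_fin.
Qed.

Section test.
Variables (g : G -> R) (W C : set G).
Hypotheses (cg : continuous g) (cC : compact C).
Hypothesis (gWC : forall x, g x != 0 -> W x /\ C x).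

Let gt (t : G) := fun x : G => (g (x - t))%:C.

Definition density_bounded (mu : set G -> R[i]) N :=
  forall t, (translate t W `&` msupport mu #<= `I_N)%card.

Lemma hit_card_le (mu : set G -> R[i]) N t : density_bounded mu N ->
  (msupport mu `&` [set x | gt t x != 0] #<= `I_N)%card.
Proof.
move=> dN; apply: card_le_trans (dN t); apply: subset_card_le => x [sx gtx].
split => //; rewrite translateE /=.
suff [] : W (x - t) /\ C (x - t) by [].
by apply: gWC; apply: contra_neq gtx; rewrite /gt => ->.
Qed.

Lemma pairing_test (mu : set G -> R[i]) N t : class_DM mu ->
  density_bounded mu N ->
  pairing mu (gt t) = \sum_(x \in msupport mu) mu [set x] * gt t x.
Proof.
move=> [radon_mu disc _] dN; apply: pairing_finite => //.
- exact: discrete_countable.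
- exact: concentrated_on_support.
- apply: continuous_borel => x.
  apply: (@cvg_comp _ _ _ (fun x => x - t) g); last exact: cg.
  exact: subr_continuousG.
- by apply/finite_set_leP; exists N; exact: hit_card_le.
Qed.

(** After reindexing by [sigma], the difference is a sum over pairs
    [(x, sigma x)]. The test function centred at [t] meets at most [N + N'] of
    them. When [t] is far away each term is small: the two masses are close, and
    so are the two values of [g], by uniform continuity. *)
Lemma test_vanishing (mu nu : set G -> R[i]) N N' :
  class_DM mu -> class_DM nu -> density_bounded mu N -> density_bounded nu N' ->
  translation_bounded nu -> close_to_infinity mu nu ->
  forall e : R, 0 < e -> exists2 K : set G, compact K &
    forall t, ~ K t -> cabs (pairing mu (gt t) - pairing nu (gt t)) <= e.
Proof.
move=> DMmu DMnu dmu dnu tb [sigma bij_sigma close] e e0.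
have [Mnu Mnu0 nuM] := atoms_bounded (DM_radon DMnu) tb.
have gC x : g x != 0 -> C x by move=> /gWC[].
have [Mg Mg0 gM] : exists2 M : R, 0 <= M & forall x, `|g x| <= M.
  have := continuous_compact (continuous_subspaceT (A := C) cg) cC.
  move=> /compact_bounded[M [_ hM]].
  exists (`|M| + 1) => [|x]; first by rewrite addr_ge0.
  have [->|/gC Cx] := eqVneq (g x) 0; first by rewrite normr0 addr_ge0.
  apply: (hM (`|M| + 1)); last by exists x.
  by rewrite (le_lt_trans (ler_norm M))// ltrDl.
pose L := (N + N')%:R + 1 : R.
have L0 : 0 < L by rewrite ltr_wpDl.
pose c := e / L; have c0 : 0 < c by rewrite divr_gt0.
have frac M : 0 <= M -> c / 2 / (M + 1) * M <= c / 2.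
  move=> M0; rewrite -mulrA; apply: ler_piMr; first by rewrite divr_ge0// ltW.
  by rewrite mulrC ler_pdivrMr ?mul1r ?lerDl// ltr_wpDl.
have e10 : 0 < c / 2 / (Mg + 1) by rewrite !divr_gt0// ltr_wpDl.
have e20 : 0 < c / 2 / (Mnu + 1) by rewrite !divr_gt0// ltr_wpDl.
have [V V0 gV] := uniform_continuity cg cC gC e20.
have [K cK closeK] := close _ _ e10 V0.
(* a translate by [t] outside [K - C] meets no point of [K] *)
exists [set x - y | x in K & y in C] => [|t nKt].
  exact: compact_sub_image.
rewrite (pairing_test _ DMmu dmu) (pairing_test _ DMnu dnu).
rewrite (reindex_fsbig sigma (msupport mu) (msupport nu)
  (fun y => nu [set y] * gt t y) bij_sigma).
pose hit := msupport mu `&` [set x | gt t x != 0].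
pose hit' := msupport mu `&` [set x | gt t (sigma x) != 0].
have hit_card : (hit #<= `I_N)%card by exact: hit_card_le.
have hit'_card : (hit' #<= `I_N')%card.
  apply: card_le_trans (hit_card_le t dnu).
  have sigma_inj : {in hit' &, injective sigma}.
    move=> x y; rewrite !inE => -[sx _] [sy _].
    by apply: (set_bij_inj bij_sigma); rewrite inE.
  have /card_eqPle[_ /card_le_trans] := inj_card_eq sigma_inj; apply.
  apply: subset_card_le => _ [x [sx gtx] <-]; split => //.
  exact: (set_bij_homo bij_sigma).
have fin_hits : finite_set (hit `|` hit').
  by rewrite finite_setU; split; apply/finite_set_leP; [exists N|exists N'].
(* [mu x g x - nu y g y = (mu x - nu y) g x + nu y (g x - g y)] *)
have term x : (hit `|` hit') x ->
    cabs (mu [set x] * gt t x - nu [set sigma x] * gt t (sigma x)) <= c.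
  move=> hitx.
  have [Vx mux] : V (x - sigma x) /\
      cabs (mu [set x] - nu [set sigma x]) < c / 2 / (Mg + 1).
    apply: closeK; first by case: hitx => -[].
    have far y : C (y - t) -> ~ K y.
      move=> Cyt Ky; apply: nKt.
      by exists y => //; exists (y - t); rewrite ?subKr.
    case: hitx => -[_ gtx]; [left|right]; apply: far; apply: gC;
      by apply: contra_neq gtx; rewrite /gt => ->.
  have gtx : cabs (gt t x) <= Mg by rewrite cabs_real.
  have gtd : cabs (gt t x - gt t (sigma x)) <= c / 2 / (Mnu + 1).
    rewrite /gt -rmorphB/= cabs_real ltW//; apply: gV.
    by rewrite opprB addrA subrK.
  rewrite (_ : _ - _ = (mu [set x] - nu [set sigma x]) * gt t x +
    nu [set sigma x] * (gt t x - gt t (sigma x))); last by ring.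
  rewrite (le_trans (ler_cabsD _ _))// !cabsM [leRHS]splitr lerD//.
    apply: le_trans (ler_pM (cabs_ge0 _) (cabs_ge0 _) (ltW mux) gtx) _.
    exact: frac.
  apply: le_trans (ler_pM (cabs_ge0 _) (cabs_ge0 _) (nuM _) gtd) _.
  by rewrite mulrC frac.
have -> : \sum_(x \in msupport mu) mu [set x] * gt t x =
    \sum_(x \in hit `|` hit') mu [set x] * gt t x.
  rewrite -(fsbig_widen (hit `|` hit'))// => [x [[]|[]]//|x].
  move=> [sx /not_orP[nhit _]].
  have [gtx|gtx] := eqVneq (gt t x) 0.
    exact: (etrans (congr1 ( *%R _) gtx) (mulr0 _)).
  by exfalso; apply: nhit.
have -> : \sum_(x \in msupport mu) nu [set sigma x] * gt t (sigma x) =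
    \sum_(x \in hit `|` hit') nu [set sigma x] * gt t (sigma x).
  rewrite -(fsbig_widen (hit `|` hit'))// => [x [[]|[]]//|x].
  move=> [sx /not_orP[_ nhit]].
  have [gtx|gtx] := eqVneq (gt t (sigma x)) 0.
    exact: (etrans (congr1 ( *%R _) gtx) (mulr0 _)).
  by exfalso; apply: nhit.
rewrite -[X in _ + X]mulN1r mulr_fsumr -fsbig_split//.
apply: le_trans (cabs_fsum_le hit_card hit'_card (ltW c0) _) _.
  by move=> x /term; rewrite /= mulN1r.
by rewrite /c mulrCA ger_pMr// ler_pdivrMr// mul1r /L lerDl.
Qed.

End test.

(** Both measures are carried by the union of the supports, hence have the same
    enumeration of atoms and, atom by atom, the same weights. *)
Lemma measure_eq_of_atoms (mu nu : set G -> R[i]) :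
  class_DM mu -> class_DM nu ->
  (forall p, mu [set p] = nu [set p]) ->
  forall A, rcborel A -> mu A = nu A.
Proof.
move=> [radon_mu disc_mu _] [radon_nu disc_nu _] eq_atoms A rA.
pose X := msupport mu `|` msupport nu.
have cX : countable X.
  rewrite (_ : X = \bigcup_b (if b then msupport mu else msupport nu)).
    by apply: bigcup_countable => // -[] _; exact: discrete_countable.
  apply/seteqP; split => [x [sx|sx]|x [[] _ sx]];
    by [exists true|exists false|left|right].
have conc (rho : set G -> R[i]) : radon_measure rho -> msupport rho `<=` X ->
    forall B, rcborel B -> rho B = rho (B `&` X).
  move=> radon_rho rhoX B rB; have bX := countable_borel T1 cX.
  rewrite (concentrated_on_support T1 sG radon_rho rB).
  rewrite (concentrated_on_support T1 sG radon_rho (rcborelI rB bX)).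
  by rewrite -setIA (setIidr rhoX).
have [e [r enum]] := concentrated_atomic R T1 cX.
have [a [mu_at aX Xr]] := enum _ radon_mu (conc _ radon_mu (@subsetUl _ _ _)).
have [b [nu_at bX Xr']] := enum _ radon_nu (conc _ radon_nu (@subsetUr _ _ _)).
have eq_ab k : X (e k) /\ r (e k) = k -> a k = b k.
  move=> [Xek rek]; have [_] := Xr _ Xek; have [_] := Xr' _ Xek.
  by rewrite rek => -> ->.
have ab : a = b.
  apply/funext => k; have [ak0|/aX/eq_ab//] := eqVneq (a k) 0.
  have [bk0|bk] := eqVneq (b k) 0; first by rewrite ak0 bk0.
  exact/eq_ab/bX.
have := atomic_sum nu_at rA; rewrite -ab => nuA.
exact: (cvg_unique _ (atomic_sum mu_at rA) nuA).
Qed.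

End close_measures.

(** * Reading off a single atom *)

Section isolated_atoms.
Context (R : realType) (G : topologicalZmodType).
Hypotheses (hG : hausdorff_space G) (sG : second_countable (T := G)).

(** Off the support the support itself, being closed, provides the
    neighborhood. *)
Lemma isolating_nbhs (mu : set G -> R[i]) p : discrete_measure mu ->
  exists2 W, nbhs 0 W & translate p W `&` msupport mu `<=` [set p].
Proof.
move=> disc; have [sp|nsp] := pselect (msupport mu p).
  by have [U U0 Up] := disc p sp; exists U => //; rewrite Up.
exists [set y | ~ msupport mu (y - - p)].
  apply: (@subr_continuousG _ (- p) 0 (~` msupport mu)).
  rewrite sub0r opprK; apply: open_nbhs_nbhs; split => //.
  by apply: closed_openC; exact: closed_msupport.
by move=> x [[y + <-]]; rewrite /= opprK addrC.
Qed.

(** A test function on so small a neighborhood, centred at [p], sees no point of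
    the support other than [p]. *)
Lemma pairing_isolated (mu : set G -> R[i]) (g : G -> R) (W C : set G) N p :
  continuous g -> compact C -> (forall x, g x != 0 -> W x /\ C x) ->
  class_DM mu -> density_bounded W mu N ->
  translate p W `&` msupport mu `<=` [set p] ->
  pairing mu (fun x => (g (x - p))%:C) = mu [set p] * (g 0)%:C.
Proof.
move=> cg cC gWC DMmu dN Wp; rewrite (pairing_test hG sG cg gWC p DMmu dN).
have T1 := hausdorff_accessible hG.
have muNp : ~ msupport mu p -> mu [set p] = 0.
  move=> nsp; apply: (measure_off_support T1 sG (DM_radon DMmu)).
    exact: rcborel_finite.
  by apply/seteqP; split => // x [->].
transitivity (\sum_(x \in [set p]) mu [set x] * (g (x - p))%:C); last first.
  by rewrite fsbig_set1 subrr.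
have [sp|nsp] := pselect (msupport mu p); last first.
  rewrite fsbig_set1 muNp// mul0r fsbig1// => x sx.
  have [->|gx] := eqVneq (g (x - p)) 0; first by rewrite mulr0.
  have := Wp x; rewrite translateE /= => Wx.
  have xp : x = p by apply: Wx; split => //; have [] := gWC _ gx.
  by case: nsp; rewrite -xp.
rewrite -[LHS](fsbig_widen [set p])//; first by move=> _ ->.
move=> x [sx nxp]; have [gx|gx] := eqVneq (g (x - p)) 0.
  by rewrite /= gx mulr0.
exfalso; apply: nxp; apply: Wp; rewrite translateE; split => //=.
by have [] := gWC _ gx.
Qed.

End isolated_atoms.

Theorem theorem1 (R : realType) (G : topologicalZmodType)
    (haar : {measure set (borelType G) -> \bar R})
    (mu nu : set G -> R[i]) (muhat nuhat : set (character R G) -> R[i]) :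
  hausdorff_space G ->
  locally_compact [set: G] ->
  @second_countable G ->
  sigma_compact [set: G] ->
  ~ compact [set: G] ->
  haar_measure haar ->
  class_DM mu -> class_DM nu ->
  translation_bounded mu -> translation_bounded nu ->
  fourier_transform haar mu muhat -> fourier_transform haar nu nuhat ->
  pure_point muhat -> pure_point nuhat ->
  close_to_infinity mu nu ->
  forall A : set G, rcborel A -> mu A = nu A.
Proof.
move=> hG lcG sG _ ncG m_haar DMmu DMnu _ tb_nu ft_mu ft_nu pp_mu pp_nu close.
apply: (measure_eq_of_atoms hG sG DMmu DMnu) => p.
have [U U0 [N dN]] := DM_finite_density DMmu.
have [U' U'0 [N' dN']] := DM_finite_density DMnu.
have [V V0 Vp] := isolating_nbhs p (DM_discrete DMmu).
have [V' V'0 V'p] := isolating_nbhs p (DM_discrete DMnu).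
pose W := U `&` U' `&` (V `&` V').
have W0 : nbhs 0 W by apply: filterI; exact: filterI.
have subW (A : set G) x : W `<=` A -> translate x W `<=` translate x A.
  by move=> WA _ [y /WA Ay <-]; exists y.
have dmu : density_bounded W mu N.
  move=> t; apply: card_le_trans (dN t); apply: subset_card_le.
  by apply: setSI; apply: subW => x [[]].
have dnu : density_bounded W nu N'.
  move=> t; apply: card_le_trans (dN' t); apply: subset_card_le.
  by apply: setSI; apply: subW => x [[]].
have Wmu : translate p W `&` msupport mu `<=` [set p].
  by apply: subset_trans Vp; apply: setSI; apply: subW => x [_ []].
have Wnu : translate p W `&` msupport nu `<=` [set p].
  by apply: subset_trans V'p; apply: setSI; apply: subW => x [_ []].
have [g [C [cg g0 cC gWC gK2]]] := test_function hG lcG sG m_haar W0.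
have gC x : g x != 0 -> C x by move=> /gWC[].
have [chi [b mu_ser]] :=
  transform_almost_periodic hG m_haar cg cC gC gK2 ft_mu pp_mu.
have [chi' [b' nu_ser]] :=
  transform_almost_periodic hG m_haar cg cC gC gK2 ft_nu pp_nu.
have := almost_periodic_vanishing ncG mu_ser nu_ser
  (test_vanishing hG sG cg cC gWC DMmu DMnu dmu dnu tb_nu close) p.
rewrite (pairing_isolated hG sG cg cC gWC DMmu dmu Wmu).
rewrite (pairing_isolated hG sG cg cC gWC DMnu dnu Wnu).
by apply: mulIf; rewrite -cabs_eq0 cabs_real normr_eq0 gt_eqF.
Qed.
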